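(* There is a polynomial time algorithm that, given any $c\in\mathbb{Z}^{d\times n}$ and any independence system $S\subseteq\{0,1\}^d$ presented by a linear optimization oracle, finds $y\in S^n$ with $$c\,\overline{y}\ \geq\ \frac{\beta}{4\cdot\lceil \log_2 n \rceil +8}\cdot \max\{c\,\overline{z}\ :\ z\in S^n\},$$ where $\beta = 1-(1-\frac 1n)^n \geq 1-\frac 1e\geq 0.6321$ is the approximation ratio of the greedy algorithm for the disjoint union problem over $S$; and if the disjoint union problem over $S$ is solvable in polynomial time, then this holds with $\beta =1$.
   Context: For a matrix $x$, $x^j$ denotes its $j$-th column. For $S\subseteq\{0,1\}^d$, $S^n$ is the set of $d\times n$ matrices all of whose columns lie in $S$. The shift $\overline{x}$ of $x\in\mathbb{R}^{d\times n}$ is the unique matrix obtained from $x$ by permuting the entries within each row so that each row is nonincreasing. For $c,x\in\mathbb{R}^{d\times n}$, $cx:=\sum_{i,j}c_{i,j}x_{i,j}$. A set $S\subseteq\{0,1\}^d$ is an independence system (downward monotone) if $0\in S$ and whenever $u\in\{0,1\}^d$ and $u\le v\in S$ then $u\in S$. A linear optimization oracle for $S$ is an oracle that, queried on $w\in\mathbb{Z}^d$, returns $s\in S$ maximizing $ws=\sum_i w_is_i$ over $S$. An algorithm is polynomial time if its running time, including the number of calls to the oracle presenting $S$, is polynomial. Disjoint Union Problem (DUP) over $S$: given a positive integer $k$ and $w\in\mathbb{Z}^d$, solve $\max\{w\sum_{j=1}^k x^j : x\in S^k,\ \sum_{j=1}^k x^j\in\{0,1\}^d\}$. The greedy algorithm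 for DUP with $n$ columns: successively for $k=1,\dots,n$ query the oracle on the weight vector obtained from $w$ by setting to $0$ the weights of all elements covered by the previously obtained vectors, obtaining $x^k\in S$; then in each row of $[x^1,\dots,x^n]$ change all $1$'s except the first to $0$. *)

(* Defs.v *)
From HB Require Import structures.
From mathcomp Require Import all_boot all_order all_algebra.
From mathcomp Require Import reals.
Set Implicit Arguments.
Unset Strict Implicit.
Unset Printing Implicit Defensive.
Import Order.TTheory GRing.Theory Num.Theory.
Local Open Scope ring_scope.

(* A 0/1 vector or matrix has boolean entries; [intmx] reads it over int. *)
Definition intmx d n (x : 'M[bool]_(d, n)) : 'M[int]_(d, n) :=
  map_mx (fun b : bool => b%:Z) x.

Definition mxdot d n (c x : 'M[int]_(d, n)) : int :=
  \sum_(i < d) \sum_(j < n) c i j * x i j.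

Definition shift d n (x : 'M[int]_(d, n)) : 'M[int]_(d, n) :=
  \matrix_(i, j) nth 0 (sort >=%R [seq x i k | k <- enum 'I_n]) j.

Definition in_power d n (S : {set 'cV[bool]_d}) (x : 'M[bool]_(d, n)) : Prop :=
  forall j, col j x \in S.

Definition independence_system d (S : {set 'cV[bool]_d}) : Prop :=
  const_mx false \in S /\
  forall u v : 'cV[bool]_d, v \in S -> (forall i, (u i ord0 <= v i ord0)%N) -> u \in S.

Definition lin_opt_oracle d (S : {set 'cV[bool]_d})
    (O : 'cV[int]_d -> 'cV[bool]_d) : Prop :=
  forall w, O w \in S /\
    forall s, s \in S -> mxdot w (intmx s) <= mxdot w (intmx (O w)).

Definition colsum d n (x : 'M[bool]_(d, n)) : 'cV[int]_d :=
  \sum_(j < n) col j (intmx x).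

Definition dup_feasible d k (S : {set 'cV[bool]_d}) (x : 'M[bool]_(d, k)) : Prop :=
  in_power S x /\ forall i, colsum x i 0 = 0 \/ colsum x i 0 = 1.

Definition dup_value d k (w : 'cV[int]_d) (x : 'M[bool]_(d, k)) : int :=
  mxdot w (colsum x).

Definition dup_optimal d k (S : {set 'cV[bool]_d}) (w : 'cV[int]_d)
    (x : 'M[bool]_(d, k)) : Prop :=
  dup_feasible S x /\
  forall x' : 'M[bool]_(d, k), dup_feasible S x' -> dup_value w x' <= dup_value w x.

Definition covered d (xs : seq 'cV[bool]_d) (i : 'I_d) : bool :=
  has (fun x : 'cV[bool]_d => x i 0) xs.

Fixpoint greedy_queries d (O : 'cV[int]_d -> 'cV[bool]_d) (w : 'cV[int]_d)
    (n : nat) : seq 'cV[bool]_d :=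
  if n is m.+1 then
    let xs := greedy_queries O w m in
    rcons xs (O (\col_i if covered xs i then 0 else w i 0))
  else [::].

Definition greedy d (O : 'cV[int]_d -> 'cV[bool]_d) (w : 'cV[int]_d)
    (n : nat) : 'M[bool]_(d, n) :=
  let xs := greedy_queries O w n in
  \matrix_(i, j) (nth (const_mx false) xs j i 0 && ~~ covered (take j xs) i).

Definition greedy_ratio (R : realType) (n : nat) : R := 1 - (1 - n%:R^-1) ^+ n.

(* Model of computation: while-programs in point-free form over data built   *)
(* from binary integers by pairing, with one instruction querying the        *)
(* optimization oracle. A program denotes a partial map from data to data.   *)

Inductive datum : Type :=
| DInt of int
| DPair of datum & datum.

(* Binary digits of |z|, plus a sign. *)
Definition int_size (z : int) : nat := (trunc_log 2 `|z|%N).+2.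

Fixpoint datum_size (v : datum) : nat :=
  match v with
  | DInt z => int_size z
  | DPair a b => (datum_size a + datum_size b).+1
  end.

Definition dlist (s : seq datum) : datum := foldr DPair (DInt 0) s.

Definition enc_vec d (w : 'cV[int]_d) : datum :=
  dlist [seq DInt (w i 0) | i <- enum 'I_d].

Definition enc_mx d n (c : 'M[int]_(d, n)) : datum :=
  dlist [seq enc_vec (col j c) | j <- enum 'I_n].

Inductive arith : Type := OpAdd | OpSub | OpMul | OpLe.

Definition arith_eval (o : arith) (a b : int) : int :=
  match o with
  | OpAdd => a + b
  | OpSub => a - b
  | OpMul => a * b
  | OpLe => Posz (a <= b)%R
  end.

Inductive prog : Type :=
| PId
| PConst of int
| PSeq of prog & prog
| PFork of prog & prog
| PFst
| PSnd
| PIsPair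
| PArith of arith
| PIf of prog & prog & prog
| PWhile of prog & prog
| PQuery.

Definition is_pair (v : datum) : bool := if v is DPair _ _ then true else false.

(* Every instruction is charged for reading its whole input and writing its  *)
(* whole output, measured in bits. Hence the running time bounds the number  *)
(* of oracle calls and the bit size of all intermediate data, and it is      *)
(* polynomially related to the running time of an oracle Turing machine.     *)
Definition step_cost (v r : datum) : nat := (datum_size v + datum_size r).+1.

(* [exec O p v r t]: on input v, p halts with output r after time t. There   *)
(* is no rule for ill-formed operands or queries: such a run does not halt.  *)
Inductive exec d (O : 'cV[int]_d -> 'cV[bool]_d) :
    prog -> datum -> datum -> nat -> Prop :=
| exec_id v : exec O PId v v (step_cost v v)
| exec_const z v : exec O (PConst z) v (DInt z) (step_cost v (DInt z))
| exec_seq p q v u r t1 t2 :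
    exec O p v u t1 -> exec O q u r t2 ->
    exec O (PSeq p q) v r (t1 + t2 + step_cost v r)
| exec_fork p q v a b t1 t2 :
    exec O p v a t1 -> exec O q v b t2 ->
    exec O (PFork p q) v (DPair a b) (t1 + t2 + step_cost v (DPair a b))
| exec_fst a b : exec O PFst (DPair a b) a (step_cost (DPair a b) a)
| exec_snd a b : exec O PSnd (DPair a b) b (step_cost (DPair a b) b)
| exec_ispair v :
    exec O PIsPair v (DInt (is_pair v)%:Z) (step_cost v (DInt (is_pair v)%:Z))
| exec_arith o a b :
    exec O (PArith o) (DPair (DInt a) (DInt b)) (DInt (arith_eval o a b))
      (step_cost (DPair (DInt a) (DInt b)) (DInt (arith_eval o a b)))
| exec_if p q1 q2 v z r t1 t2 :
    exec O p v (DInt z) t1 -> exec O (if z != 0 then q1 else q2) v r t2 ->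
    exec O (PIf p q1 q2) v r (t1 + t2 + step_cost v r)
| exec_while_stop p q v t :
    exec O p v (DInt 0) t ->
    exec O (PWhile p q) v v (t + step_cost v v)
| exec_while_loop p q v z u r t1 t2 t3 :
    exec O p v (DInt z) t1 -> z != 0 ->
    exec O q v u t2 -> exec O (PWhile p q) u r t3 ->
    exec O (PWhile p q) v r (t1 + t2 + t3 + step_cost v r)
| exec_query w :
    exec O PQuery (enc_vec w) (enc_vec (intmx (O w)))
      (step_cost (enc_vec w) (enc_vec (intmx (O w)))).

Lemma enc_vec_inj d : injective (@enc_vec d).
Proof.
have vl : injective dlist.
  by elim=> [|x s IH] [|y s'] //= [-> /IH ->].
move=> w w' /vl /eq_in_map H; apply/matrixP => i j; rewrite ord1.
by have [] := H i (mem_enum _ _).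
Qed.

Lemma exec_det d (O : 'cV[int]_d -> 'cV[bool]_d) p v r t r' t' :
  exec O p v r t -> exec O p v r' t' -> r = r' /\ t = t'.
Proof.
move=> H; move: r' t'; elim: H => {p v r t}.
- by move=> v r' t' H; inversion H.
- by move=> z v r' t' H; inversion H.
- move=> p q v u r t1 t2 _ IH1 _ IH2 r' t' H; inversion H; subst.
  have [? ?] := IH1 _ _ ltac:(eassumption); subst.
  by have [? ?] := IH2 _ _ ltac:(eassumption); subst.
- move=> p q v a b t1 t2 _ IH1 _ IH2 r' t' H; inversion H; subst.
  have [? ?] := IH1 _ _ ltac:(eassumption); subst.
  by have [? ?] := IH2 _ _ ltac:(eassumption); subst.
- by move=> a b r' t' H; inversion H.
- by move=> a b r' t' H; inversion H.
- by move=> v r' t' H; inversion H.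
- by move=> o a b r' t' H; inversion H.
- move=> p q1 q2 v z r t1 t2 _ IH1 _ IH2 r' t' H; inversion H; subst.
  have [[?] ?] := IH1 _ _ ltac:(eassumption); subst.
  by have [? ?] := IH2 _ _ ltac:(eassumption); subst.
- move=> p q v t _ IH r' t' H; inversion H; subst.
    by have [_ ->] := IH _ _ ltac:(eassumption).
  by have [[E] _] := IH _ _ ltac:(eassumption); subst.
- move=> p q v z u r t1 t2 t3 _ IH1 nz _ IH2 _ IH3 r' t' H; inversion H; subst.
    by have [[E] _] := IH1 _ _ ltac:(eassumption); subst.
  have [_ ?] := IH1 _ _ ltac:(eassumption); subst.
  have [? ?] := IH2 _ _ ltac:(eassumption); subst.
  by have [? ?] := IH3 _ _ ltac:(eassumption); subst.
- move=> w r' t' H; inversion H as [| | | | | | | | | | |w' E1 E2 E3 E4].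
  by rewrite (enc_vec_inj E2).
Qed.

(* Polynomial solvability of a problem over S is meaningful for S ranging    *)
(* over a class of systems with unbounded ground sets, not for one finite S. *)
Definition set_class : Type := forall d, {set 'cV[bool]_d} -> Prop.

(* A solution of the problem has k columns, so time is measured with k       *)
(* in unary.                                                                 *)
Definition dup_polytime (C : set_class) : Prop :=
  exists (P : prog) (T : {poly nat}),
    forall (d : nat) (S : {set 'cV[bool]_d}) (O : 'cV[int]_d -> 'cV[bool]_d)
           (k : nat) (w : 'cV[int]_d),
      C d S -> lin_opt_oracle S O -> (0 < k)%N ->
      let input := DPair (DInt k%:Z) (enc_vec w) in
      exists (x : 'M[bool]_(d, k)) (t : nat),
        [/\ exec O P input (enc_mx (intmx x)) t,
            (t <= T.[k + datum_size input])%N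
          & dup_optimal S w x].

Definition shifted_approx_polytime (R : realType) (C : set_class)
    (rho : nat -> R) : Prop :=
  exists (P : prog) (T : {poly nat}),
    forall (d n : nat) (c : 'M[int]_(d, n)) (S : {set 'cV[bool]_d})
           (O : 'cV[int]_d -> 'cV[bool]_d),
      (0 < n)%N -> C d S -> lin_opt_oracle S O ->
      exists (y : 'M[bool]_(d, n)) (t : nat),
        [/\ exec O P (enc_mx c) (enc_mx (intmx y)) t,
            (t <= T.[datum_size (enc_mx c)])%N,
            in_power S y
          & forall z : 'M[bool]_(d, n), in_power S z ->
              rho n * (mxdot c (shift (intmx z)))%:~R
                <= (mxdot c (shift (intmx y)))%:~R].

(* Main.v *)
Require Import Defs.
From HB Require Import structures.
From mathcomp Require Import all_boot all_order all_algebra.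
From mathcomp Require Import reals sequences exp.
From mathcomp Require Import zify ring lra.
Set Implicit Arguments.
Unset Strict Implicit.
Unset Printing Implicit Defensive.
Import Order.TTheory GRing.Theory Num.Theory.
Local Open Scope ring_scope.

(* For row i let f_i m be the sum of the first m entries of row i of c. The
   value of y is then the sum over i of f_i (number of ones in row i of y).
   For each p <= n, put b_i = f_i m_i where m_i maximizes f_i over [0, p], and
   cover rows greedily with n / p blocks of p equal columns, each block given
   by one oracle call on the weights b of the uncovered rows; a covered row
   keeps exactly m_i of its p ones. If z is feasible then any oracle answer
   gains at least the average over the columns of z, so the rows with between
   p / 2 and p ones in z contribute at most 4 times the weight covered
   (Bernoulli). Grouping the rows of z by the binary logarithm of their counts
   shows that the best p loses a factor of at most 4 (log n + 1). The ratio beta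
   does not appear, so the same program also proves the last claim, and the
   disjoint union problem is never solved. *)

(** * Polynomial bounds and bit sizes *)

(** Averaging the weights b over the columns of z counts row i with multiplicity (number of ones) /
    n, which is at least p / (2 n) once the row has p / 2 ones. A block therefore removes at least
    the fraction p / (2 n) of what is left, and floor(n / p) blocks leave at most 3/4; the extreme
    case is p just above n / 2, where a single block fits. Downward monotonicity is what allows a
    row to stop after m_i ones: every emitted column lies below the answer that opened its block.

    On the side of running time, the obstacle is that a polynomial bound for a loop body gives none
    for the loop, whose state may double in each round. Time statements therefore carry a domain of
    admissible inputs, and loops carry an invariant. For the two main loops the invariant names the
    state exactly: runs are deterministic, and the correctness lemmas already give their results. *)

Definition poly_bounded (f : nat -> nat) : Prop :=
  exists T : {poly nat}, forall x, (f x <= T.[x])%N.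

(** Coefficients in [nat] make every polynomial monotone, so a bound at an intermediate size can be
    moved to any larger size. *)
Lemma leq_horner (T : {poly nat}) (x y : nat) : (x <= y -> T.[x] <= T.[y])%N.
Proof.
move=> le_xy; rewrite !horner_coef.
apply: (@leq_sum _ _ _ (fun i : 'I_(size T) => T`_i * x ^+ i)%R
  (fun i : 'I_(size T) => T`_i * y ^+ i)%R) => i _.
rewrite leq_mul //; case: (nat_of_ord i) => [|k] //.
by rewrite !natrXE leq_exp2r.
Qed.

Lemma hornerS (T : {poly nat}) (x : nat) : (T + 1%:P).[x] = T.[x].+1.
Proof. by rewrite hornerD hornerC -addn1. Qed.

Lemma horner_compS (T : {poly nat}) (x : nat) :
  ((T \Po ('X + 1%:P)) + 1%:P).[x] = T.[x.+1].+1 :> nat.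
Proof. by rewrite hornerS horner_comp hornerS hornerX. Qed.

Lemma poly_bounded_const (a : nat) : poly_bounded (fun=> a).
Proof. by exists (a%:P) => x; rewrite hornerC. Qed.

Lemma poly_bounded_id : poly_bounded id.
Proof. by exists 'X => x; rewrite hornerX. Qed.

Lemma poly_boundedD f g :
  poly_bounded f -> poly_bounded g -> poly_bounded (fun x => f x + g x)%N.
Proof.
by move=> [T fT] [U gU]; exists (T + U) => x; rewrite hornerD leq_add.
Qed.

Lemma poly_boundedM f g :
  poly_bounded f -> poly_bounded g -> poly_bounded (fun x => f x * g x)%N.
Proof.
by move=> [T fT] [U gU]; exists (T * U) => x; rewrite hornerM leq_mul.
Qed.

Lemma poly_boundedS f : poly_bounded f -> poly_bounded (fun x => (f x).+1).
Proof.
move=> [T fT]; exists (T + 1%:P) => x.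
by rewrite hornerS ltnS.
Qed.

Lemma poly_bounded_horner (T : {poly nat}) g :
  poly_bounded g -> poly_bounded (fun x => T.[g x])%N.
Proof.
move=> [U gU]; exists (T \Po U) => x; rewrite horner_comp.
exact: leq_horner.
Qed.

(* Time bounds are written below as arithmetic expressions in the input size; search over these
   closure lemmas turns them into polynomials. *)
Create HintDb polyb.
#[export] Hint Resolve poly_bounded_const poly_bounded_id poly_boundedD
  poly_boundedM poly_boundedS poly_bounded_horner : polyb.

Lemma int_size_gt1 z : (1 < int_size z)%N. Proof. by []. Qed.

(** With [int_sizeP] this translates bit sizes into powers of two and back. The offset 2 is the sign
    plus the one digit that [trunc_log] does not count. *)
Lemma int_size_leP (a : int) k : (`|a| < 2 ^ k.+1)%N -> (int_size a <= k.+2)%N.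
Proof.
move=> ak; rewrite /int_size !ltnS.
case: (posnP `|a|%N) => [->|a0]; first by rewrite trunc_log0.
rewrite -ltnS -(ltn_exp2l _ _ (isT : 1 < 2)%N).
by apply: leq_ltn_trans ak; apply: trunc_logP.
Qed.

Lemma int_sizeP (a : int) : (`|a| < 2 ^ (int_size a).-1)%N.
Proof. by rewrite /int_size /= trunc_log_ltn. Qed.

Lemma int_sizeD (a b : int) : (int_size (a + b) <= int_size a + int_size b)%N.
Proof.
have := int_sizeP a; have := int_sizeP b.
have := int_size_gt1 a; have := int_size_gt1 b.
case: (int_size a) (int_size b) => [|[|k]] [|[|l]] //= _ _ hb ha.
rewrite !addSn !addnS; apply: leqW; apply: int_size_leP.
have ab : (`|(a + b)%R| <= `|a| + `|b|)%N by lia.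
apply: (leq_ltn_trans ab).
have h1 : (2 ^ k.+1 <= 2 ^ (k + l).+1)%N by rewrite leq_exp2l // ltnS leq_addr.
have h2 : (2 ^ l.+1 <= 2 ^ (k + l).+1)%N by rewrite leq_exp2l // ltnS leq_addl.
rewrite [X in (_ < X)%N]expnS; lia.
Qed.

Lemma int_sizeN a : int_size (- a) = int_size a.
Proof. by rewrite /int_size abszN. Qed.

Lemma int_sizeB (a b : int) : (int_size (a - b) <= int_size a + int_size b)%N.
Proof. by rewrite -(int_sizeN b) int_sizeD. Qed.

(** Both operands pay for a sign, so even a product fits in their total size. Hence no arithmetic
    instruction enlarges its input. *)
Lemma int_sizeM (a b : int) : (int_size (a * b) <= int_size a + int_size b)%N.
Proof.
have := int_sizeP a; have := int_sizeP b.
have := int_size_gt1 a; have := int_size_gt1 b.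
case: (int_size a) (int_size b) => [|[|k]] [|[|l]] //= _ _ hb ha.
rewrite !addSn !addnS; apply: leqW; apply: int_size_leP.
rewrite abszM; apply: (@leq_trans (2 ^ k.+1 * 2 ^ l.+1)%N); last first.
  by rewrite -expnD addSn addnS.
by apply: ltn_mul.
Qed.

Lemma datum_size_dlist (s : seq datum) :
  datum_size (dlist s) = (\sum_(x <- s) (datum_size x).+1 + 2)%N.
Proof.
elim: s => [|x s IH]; first by rewrite big_nil.
by rewrite big_cons /= IH addSn addnA.
Qed.

Definition dvec d (F : 'I_d -> datum) : datum :=
  dlist [seq F i | i <- enum 'I_d].

Lemma datum_size_dvec d (F : 'I_d -> datum) :
  datum_size (dvec F) = (\sum_(i < d) (datum_size (F i)).+1 + 2)%N.
Proof. by rewrite datum_size_dlist big_map big_enum. Qed.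

(** Each rule charges its own input and output, so a time bound is also a bound on the output size;
    compositions need no separate size estimate. *)
Lemma exec_size d (O : 'cV[int]_d -> 'cV[bool]_d) p v r t :
  exec O p v r t -> (datum_size v + datum_size r <= t)%N.
Proof.
by case=> *; first [exact: leqnSn | exact: leq_trans (leqnSn _) (leq_addl _ _)].
Qed.

(** * Evaluation rules and their inversions *)

Definition evals d (O : 'cV[int]_d -> 'cV[bool]_d) p v r : Prop :=
  exists t, exec O p v r t.

Section EvalRules.
Variables (d : nat) (O : 'cV[int]_d -> 'cV[bool]_d).

Lemma evals_id v : evals O PId v v.
Proof. by eexists; apply: exec_id. Qed.

Lemma evals_const z v : evals O (PConst z) v (DInt z).
Proof. by eexists; apply: exec_const. Qed.

Lemma evals_seq p q v u r :
  evals O p v u -> evals O q u r -> evals O (PSeq p q) v r.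
Proof. by move=> [t1 h1] [t2 h2]; eexists; apply: exec_seq h1 h2. Qed.

Lemma evals_fork p q v a b :
  evals O p v a -> evals O q v b -> evals O (PFork p q) v (DPair a b).
Proof. by move=> [t1 h1] [t2 h2]; eexists; apply: exec_fork h1 h2. Qed.

Lemma evals_fst a b : evals O PFst (DPair a b) a.
Proof. by eexists; apply: exec_fst. Qed.

Lemma evals_snd a b : evals O PSnd (DPair a b) b.
Proof. by eexists; apply: exec_snd. Qed.

Lemma evals_ispair v : evals O PIsPair v (DInt (is_pair v)%:Z).
Proof. by eexists; apply: exec_ispair. Qed.

Lemma evals_arith o a b :
  evals O (PArith o) (DPair (DInt a) (DInt b)) (DInt (arith_eval o a b)).
Proof. by eexists; apply: exec_arith. Qed.

Lemma evals_if p q1 q2 v (b : bool) r :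
  evals O p v (DInt b%:Z) -> evals O (if b then q1 else q2) v r ->
  evals O (PIf p q1 q2) v r.
Proof.
move=> [t1 h1] [t2 h2]; eexists; apply: (exec_if h1 (t2 := t2)).
by case: b {h1} h2.
Qed.

Lemma evals_query w : evals O PQuery (enc_vec w) (enc_vec (intmx (O w))).
Proof. by eexists; apply: exec_query. Qed.

Lemma exec_seqE p q v r t : exec O (PSeq p q) v r t ->
  exists u t1 t2,
    [/\ exec O p v u t1, exec O q u r t2 & t = (t1 + t2 + step_cost v r)%N].
Proof. by move=> h; inversion h; subst; do 3 eexists; split; eauto. Qed.

Lemma exec_forkE p q v r t : exec O (PFork p q) v r t ->
  exists a b t1 t2,
    [/\ exec O p v a t1, exec O q v b t2, r = DPair a b
      & t = (t1 + t2 + step_cost v r)%N].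
Proof. by move=> h; inversion h; subst; do 4 eexists; split; eauto. Qed.

Lemma exec_ifE p q1 q2 v r t : exec O (PIf p q1 q2) v r t ->
  exists z t1 t2,
    [/\ exec O p v (DInt z) t1, exec O (if z != 0 then q1 else q2) v r t2
      & t = (t1 + t2 + step_cost v r)%N].
Proof. by move=> h; inversion h; subst; do 3 eexists; split; eauto. Qed.

Lemma evals_seqE p q v r : evals O (PSeq p q) v r ->
  exists2 u, evals O p v u & evals O q u r.
Proof. by move=> [t /exec_seqE[u [t1 [t2 [h1 h2 _]]]]]; exists u; eexists; eauto. Qed.

Lemma evals_forkE p q v r : evals O (PFork p q) v r ->
  exists a b, [/\ r = DPair a b, evals O p v a & evals O q v b].
Proof.
move=> [t /exec_forkE[a [b [t1 [t2 [h1 h2 -> _]]]]]]; exists a, b.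
by split=> //; eexists; eauto.
Qed.

Lemma evals_fstE v r : evals O PFst v r -> exists b, v = DPair r b.
Proof. by move=> [t h]; inversion h; eexists. Qed.

Lemma evals_sndE v r : evals O PSnd v r -> exists a, v = DPair a r.
Proof. by move=> [t h]; inversion h; eexists. Qed.

Lemma evals_arithE o v r : evals O (PArith o) v r ->
  exists a b, v = DPair (DInt a) (DInt b) /\ r = DInt (arith_eval o a b).
Proof. by move=> [t h]; inversion h; do 2 eexists. Qed.

(** Combined with a correctness lemma, this identifies the result of any run on a known encoding;
    the invariants of the main loops rest on it. *)
Lemma evals_det p v r r' : evals O p v r -> evals O p v r' -> r = r'.
Proof. by move=> [t h] [t' h']; have [] := exec_det h h'. Qed.

End EvalRules.

(** * Programs with polynomially bounded running time *)

Definition domain : Type := forall d, ('cV[int]_d -> 'cV[bool]_d) -> datum -> Prop.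

(* Only halting runs are constrained: whether a run halts, and with which *)
(* output, is the business of [evals]. *)
Definition ptime_on (D : domain) (p : prog) : Prop :=
  exists T : {poly nat}, forall d (O : 'cV[int]_d -> 'cV[bool]_d) v r t,
    D d O v -> exec O p v r t -> (t <= T.[datum_size v])%N.

Definition anywhere : domain := fun _ _ _ => True.

Notation ptime := (ptime_on anywhere).

Lemma ptime_onI (D : domain) p f : poly_bounded f ->
  (forall d (O : 'cV[int]_d -> 'cV[bool]_d) v r t,
     D d O v -> exec O p v r t -> (t <= f (datum_size v))%N) -> ptime_on D p.
Proof.
by move=> [T fT] pf; exists T => d O v r t Dv /pf -/(_ Dv) /leq_trans; apply.
Qed.

Lemma ptime_onW (D D' : domain) p :
  (forall d O v, D d O v -> D' d O v) -> ptime_on D' p -> ptime_on D p.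
Proof. by move=> DD' [T pT]; exists T => d O v r t /DD'; apply: pT. Qed.

Lemma ptime_sub (D : domain) p : ptime p -> ptime_on D p.
Proof. exact: ptime_onW. Qed.

Lemma ptime_seq_on (D D' : domain) p q :
  ptime_on D p -> ptime_on D' q ->
  (forall d O v u, D d O v -> @evals d O p v u -> D' d O u) ->
  ptime_on D (PSeq p q).
Proof.
move=> [T pT] [U qU] DD'.
(* The intermediate datum is no larger than the time spent on producing it, hence the argument
   [T.[x]] of [U]. *)
apply: (@ptime_onI _ _ (fun x => T.[x] + U.[T.[x]] + (x + U.[T.[x]]).+1)%N).
  by auto 10 with polyb.
move=> d O v r t Dv /exec_seqE[u [t1 [t2 [e1 e2 ->]]]].
have h1 := pT _ _ _ _ _ Dv e1.
have h2 := qU _ _ _ _ _ (DD' _ _ _ _ Dv (ex_intro _ _ e1)) e2.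
have s1 := exec_size e1; have s2 := exec_size e2.
have := @leq_horner U (datum_size u) T.[datum_size v].
by rewrite /step_cost; lia.
Qed.

Lemma ptime_fork_on (D : domain) p q :
  ptime_on D p -> ptime_on D q -> ptime_on D (PFork p q).
Proof.
move=> [T pT] [U qU].
apply: (@ptime_onI _ _ (fun x => T.[x] + U.[x] + (x + (T.[x] + U.[x]).+1).+1)%N).
  by auto 10 with polyb.
move=> d O v r t Dv /exec_forkE[a [b [t1 [t2 [e1 e2 -> ->]]]]].
have h1 := pT _ _ _ _ _ Dv e1; have h2 := qU _ _ _ _ _ Dv e2.
have s1 := exec_size e1; have s2 := exec_size e2.
by rewrite /step_cost /=; lia.
Qed.

Lemma ptime_if_on (D : domain) p q1 q2 :
  ptime_on D p -> ptime_on D q1 -> ptime_on D q2 -> ptime_on D (PIf p q1 q2).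
Proof.
move=> [T pT] [U qU] [V rV].
apply: (@ptime_onI _ _ (fun x => T.[x] + (U.[x] + V.[x])
  + (x + (U.[x] + V.[x])).+1)%N).
  by auto 10 with polyb.
move=> d O v r t Dv /exec_ifE[z [t1 [t2 [e1 e2 ->]]]].
have h1 := pT _ _ _ _ _ Dv e1; have s2 := exec_size e2.
have h2 : (t2 <= U.[datum_size v] + V.[datum_size v])%N.
  case: ifP e2 => _ e2; first by have := qU _ _ _ _ _ Dv e2; lia.
  by have := rV _ _ _ _ _ Dv e2; lia.
by rewrite /step_cost /=; lia.
Qed.

Lemma ptime_atom p f :
  poly_bounded f ->
  (forall d O v r t, @exec d O p v r t ->
     t = step_cost v r /\ (datum_size r <= f (datum_size v))%N) ->
  ptime p.
Proof.
move=> pf h; apply: (@ptime_onI _ _ (fun x => (x + f x).+1)).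
  by auto with polyb.
by move=> d O v r t _ /h [-> rf]; rewrite /step_cost ltnS leq_add2l.
Qed.

Lemma ptime_id : ptime PId.
Proof. by apply: (@ptime_atom _ id); auto with polyb => d O v r t h; inversion h. Qed.

Lemma ptime_const z : ptime (PConst z).
Proof.
apply: (@ptime_atom _ (fun=> datum_size (DInt z))); auto with polyb.
by move=> d O v r t h; inversion h.
Qed.

Lemma ptime_fst : ptime PFst.
Proof.
apply: (@ptime_atom _ id); auto with polyb.
by move=> d O v r t h; inversion h; subst; split=> //=; lia.
Qed.

Lemma ptime_snd : ptime PSnd.
Proof.
apply: (@ptime_atom _ id); auto with polyb.
by move=> d O v r t h; inversion h; subst; split=> //=; lia.
Qed.

Lemma ptime_ispair : ptime PIsPair.
Proof.
apply: (@ptime_atom _ (fun=> 2)); auto with polyb.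
by move=> d O v r t h; inversion h; subst; split=> //=; case: is_pair.
Qed.

Lemma ptime_arith o : ptime (PArith o).
Proof.
apply: (@ptime_atom _ id); auto with polyb.
move=> d O v r t h; inversion h; subst; split=> //; apply: leqW.
case: o {h} => /=.
- exact: int_sizeD.
- exact: int_sizeB.
- exact: int_sizeM.
apply: (@leq_trans 2); first by case: (a <= b)%R.
by apply: ltn_addr; apply: int_size_gt1.
Qed.

Lemma ptime_query : ptime PQuery.
Proof.
apply: (@ptime_atom _ id); auto with polyb.
move=> d O v r t h; inversion h; subst; split=> //.
(* The answer has as many entries as the query, and 0 and 1 have the least size an integer can
   have. *)
rewrite !datum_size_dvec leq_add2r; apply: leq_sum => i _ /=.
by rewrite ltnS mxE; case: (O w i 0).
Qed.

(** * Loops over lists *)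

Lemma exec_whileE d (O : 'cV[int]_d -> 'cV[bool]_d) p q v r t :
  exec O (PWhile p q) v r t ->
  (exists t1, [/\ exec O p v (DInt 0) t1, r = v & t = (t1 + step_cost v v)%N]) \/
  (exists z u t1 t2 t3, [/\ exec O p v (DInt z) t1, z != 0, exec O q v u t2,
     exec O (PWhile p q) u r t3 & t = (t1 + t2 + t3 + step_cost v r)%N]).
Proof.
move=> h; inversion h; subst; first by left; eexists; split; eauto.
by right; do 5 eexists; split; eauto.
Qed.

(* [J k v]: the loop can reach the state [v] with at most [k] rounds left. *)
Lemma while_time d (O : 'cV[int]_d -> 'cV[bool]_d) p q
    (J : nat -> datum -> Prop) (M tp tq : nat) :
  (forall k v, J k v -> datum_size v <= M)%N ->
  (forall k v r t, J k v -> exec O p v r t -> t <= tp)%N ->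
  (forall k v r t, J k v -> exec O q v r t -> t <= tq)%N ->
  (forall k v z u, J k v -> evals O p v (DInt z) -> z != 0 -> evals O q v u ->
     exists2 k', k = k'.+1 & J k' u) ->
  forall k v r t, J k v -> exec O (PWhile p q) v r t ->
  (t <= k.+1 * (tp + tq + M + M).+1)%N /\ exists k', J k' r.
Proof.
move=> hM hp hq hJ; elim=> [|k IH] v r t Jv /exec_whileE.
  case=> [[t1 [e1 -> ->]]|[z [u [t1 [t2 [t3 [e1 nz e2 e3 ->]]]]]]].
    split; last by exists 0%N.
    by have := hp _ _ _ _ Jv e1; have := hM _ _ Jv; rewrite /step_cost; lia.
  by have [] := hJ _ _ _ _ Jv (ex_intro _ _ e1) nz (ex_intro _ _ e2).
case=> [[t1 [e1 -> ->]]|[z [u [t1 [t2 [t3 [e1 nz e2 e3 ->]]]]]]].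
  split; last by exists k.+1.
  by have := hp _ _ _ _ Jv e1; have := hM _ _ Jv; rewrite /step_cost; lia.
have [k' [<-] Ju] := hJ _ _ _ _ Jv (ex_intro _ _ e1) nz (ex_intro _ _ e2).
have [h3 [k'' Jr]] := IH u r t3 Ju e3.
split; last by exists k''.
have := hp _ _ _ _ Jv e1; have := hq _ _ _ _ Jv e2.
have := hM _ _ Jv; have := hM _ _ Jr; rewrite /step_cost mulSn; lia.
Qed.

(** List length extended to arbitrary data, since a time bound may not presuppose that a loop runs
    over an encoded list. *)
Fixpoint spine (v : datum) : nat := if v is DPair _ w then (spine w).+1 else 0.

Lemma spine_size v : (spine v <= datum_size v)%N.
Proof. by elim: v => //= a _ b IH; lia. Qed.

(* State (list, (environment, accumulator)); the body maps
   (head, (environment, accumulator)) to the next accumulator. *)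
Definition p_fold_step body :=
  PFork (PSeq PFst PSnd)
    (PFork (PSeq PSnd PFst) (PSeq (PFork (PSeq PFst PFst) PSnd) body)).

Definition p_fold body :=
  PSeq (PWhile (PSeq PFst PIsPair) (p_fold_step body)) (PSeq PSnd PSnd).

Lemma evals_p_fold_stepE d (O : 'cV[int]_d -> 'cV[bool]_d) body v u :
  evals O (p_fold_step body) v u -> exists x L E A r,
    [/\ v = DPair (DPair x L) (DPair E A), u = DPair L (DPair E r)
      & evals O body (DPair x (DPair E A)) r].
Proof.
move=> /evals_forkE[L [B [-> /evals_seqE[b /evals_fstE[B' ->]]]]].
move=> /evals_sndE[x ->] /evals_forkE[E [r [-> /evals_seqE[B2]]]].
move=> /evals_sndE[? [_ ->]] /evals_fstE[A ->] /evals_seqE[w].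
move=> /evals_forkE[x' [B3 [-> /evals_seqE[?]]]].
move=> /evals_fstE[? [<- _]] /evals_fstE[? [<- _]] /evals_sndE[? [_ <-]] ?.
by exists x, L, E, A, r.
Qed.

Lemma p_fold_formE d (O : 'cV[int]_d -> 'cV[bool]_d) body v r :
  evals O (p_fold body) v r -> exists L E A, v = DPair L (DPair E A).
Proof.
move=> /evals_seqE[u [t /exec_whileE[]]].
  move=> [_ [_ -> _]] /evals_seqE[B /evals_sndE[L ->] /evals_sndE[E ->]].
  by exists L, E, r.
move=> [z [w [_ [t2 [_ [_ _ e _ _]]]]]] _.
have [x [L [E [A [? [-> _ _]]]]]] := evals_p_fold_stepE (ex_intro _ _ e).
by exists (DPair x L), E, A.
Qed.

Lemma ptime_p_fold_step (D D' : domain) body :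
  ptime_on D' body ->
  (forall d (O : 'cV[int]_d -> 'cV[bool]_d) x L B,
     D d O (DPair (DPair x L) B) -> D' d O (DPair x B)) ->
  ptime_on D (p_fold_step body).
Proof.
have tfs (p q : prog) : ptime p -> ptime q -> ptime (PSeq p q).
  by move=> tp tq; apply: ptime_seq_on tp tq _.
move=> tb DD'; apply: ptime_fork_on.
  exact: ptime_sub (tfs _ _ ptime_fst ptime_snd).
apply: ptime_fork_on; first exact: ptime_sub (tfs _ _ ptime_snd ptime_fst).
apply: (@ptime_seq_on D D') => //.
  apply: ptime_sub; apply: ptime_fork_on ptime_snd.
  exact: tfs ptime_fst ptime_fst.
move=> d O v u Dv e; move: e Dv => /evals_forkE[x [B [-> /evals_seqE[w]]]].
move=> /evals_fstE[C ->] /evals_fstE[L ->] /evals_sndE[? [_ <-]].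
exact: DD'.
Qed.

(** The relation [K], chosen for each run, ties the unread list to the accumulator. It keeps the
    body inside the domain [Db] of its time bound and keeps both data polynomial in the initial
    state; the list itself bounds the number of rounds. *)
Lemma ptime_p_fold_on (D Db : domain) body (P : {poly nat}) :
  ptime_on Db body ->
  (forall d (O : 'cV[int]_d -> 'cV[bool]_d) L0 E A0,
     let v0 := DPair L0 (DPair E A0) in
     D d O v0 ->
     exists K : datum -> datum -> Prop,
       [/\ K L0 A0,
           forall x L A, K (DPair x L) A -> Db d O (DPair x (DPair E A)),
           forall x L A r, K (DPair x L) A ->
             evals O body (DPair x (DPair E A)) r -> K L r
         & forall L A, K L A ->
             (datum_size L + datum_size A <= P.[datum_size v0])%N]) ->
  ptime_on D (p_fold body).
Proof.
move=> tb hD.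
pose D2 : domain := fun d O v => forall x L B,
  v = DPair (DPair x L) B -> Db d O (DPair x B).
have [U tU] : ptime_on D2 (p_fold_step body).
  by apply: ptime_p_fold_step tb _ => d O x L B; apply.
have [V tV] : ptime (PSeq PFst PIsPair) by apply: ptime_seq_on ptime_fst ptime_ispair _.
have [W tW] : ptime (PSeq PSnd PSnd) by apply: ptime_seq_on ptime_snd ptime_snd _.
pose M x := (x + P.[x]).+2.
pose loop x := (x.+1 * (V.[M x] + U.[M x] + M x + M x).+1)%N.
apply: (@ptime_onI _ _ (fun x => loop x + W.[loop x] + (x + W.[loop x]).+1)%N).
  by rewrite /loop /M; auto 20 with polyb.
move=> d O v r t Dv e; have [L0 [E [A0 v0E]]] := p_fold_formE (ex_intro _ t e).
move: e; rewrite {v}v0E in Dv *; set v0 := DPair _ _ in Dv *.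
move=> /exec_seqE[u [t1 [t2 [e1 e2 ->]]]].
have [K [K0 Kb KS Kle]] := hD _ _ _ _ _ Dv.
(* The rounds left are counted by the spine of the unread list. *)
pose J k w := exists L A, [/\ w = DPair L (DPair E A), K L A & spine L = k].
have JM k w : J k w -> (datum_size w <= M (datum_size v0))%N.
  by move=> [L [A [-> /Kle + _]]]; rewrite /M /=; lia.
have [|||| h1 _] := @while_time d O _ _ J (M (datum_size v0))
    V.[M (datum_size v0)] U.[M (datum_size v0)] JM _ _ _ (spine L0) v0 u t1 _ e1.
- move=> k w r' t' Jw /(tV _ _ _ _ _ I)/leq_trans; apply.
  exact: leq_horner (JM _ _ Jw).
- move=> k w r' t' Jw /tU h; apply: leq_trans (leq_horner U (JM _ _ Jw)).
  apply: h; move: Jw => [L [A [-> KLA _]]] x L' B [LE <-].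
  by apply: Kb (L') _ _; rewrite -LE.
- move=> k w z u' [L [A [-> KLA <-]]] _ _ /evals_p_fold_stepE[x [L' [E' [A' [r' [[? ? ?] -> h]]]]]].
  subst; exists (spine L') => //; exists L', r'; split=> //.
  exact: KS KLA h.
- by exists L0, A0.
have h2 := tW _ _ _ _ _ I e2; have s1 := exec_size e1; have s2 := exec_size e2.
have h3 : (t1 <= loop (datum_size v0))%N.
  apply: leq_trans h1 _; rewrite /loop leq_mul2r ltnS.
  by apply/orP; right; apply: leq_trans (spine_size _) _; rewrite /=; lia.
have h4 : (W.[datum_size u] <= W.[loop (datum_size v0)])%N by apply: leq_horner; lia.
by rewrite /step_cost; lia.
Qed.

(** Growth per round that depends only on the list element and the environment excludes doubling:
    both fit in the initial state, so the total growth is at most the list length times one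
    polynomial. *)
Lemma ptime_p_fold body (G : {poly nat}) :
  ptime body ->
  (forall d (O : 'cV[int]_d -> 'cV[bool]_d) x E A r,
     evals O body (DPair x (DPair E A)) r ->
     datum_size r <= datum_size A + G.[(datum_size x + datum_size E)%N])%N ->
  ptime (p_fold body).
Proof.
move=> tb hG.
(* The terms stand for the unread list, the initial accumulator, and the growth over at most as many
   rounds as the input is large. *)
pose P : {poly nat} := 'X + 'X + 'X * G.
apply: (ptime_p_fold_on (P := P) tb) => d O L0 E A0 v0 _.
pose g := G.[datum_size v0].
exists (fun L A => datum_size L <= datum_size L0 /\
  datum_size A + spine L * g <= datum_size A0 + spine L0 * g)%N; split=> //.
  move=> x L A r [/= Ls As] /hG rs; split; first lia.
  have h : (G.[(datum_size x + datum_size E)%N] <= g)%N.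
    by apply: leq_horner; rewrite /=; lia.
  by move: As; rewrite mulSn; lia.
move=> L A [Ls As]; rewrite /P !hornerD hornerM hornerX.
have h : (spine L0 * g <= datum_size v0 * g)%N.
  by rewrite leq_mul2r; apply/orP; right; apply: leq_trans (spine_size _) _; rewrite /=; lia.
change (datum_size L + datum_size A <= datum_size v0 + datum_size v0 + datum_size v0 * g)%N.
by rewrite /= in h *; lia.
Qed.

(* [encY] may depend on the part of the list that remains to be read. *)
Lemma evals_p_fold_rest d (O : 'cV[int]_d -> 'cV[bool]_d) (X Y : Type)
    (encX : X -> datum) (encY : seq X -> Y -> datum) (g : Y -> X -> Y) body E s y :
  (forall x s y,
    evals O body (DPair (encX x) (DPair E (encY (x :: s) y))) (encY s (g y x))) ->
  evals O (p_fold body) (DPair (dlist (map encX s)) (DPair E (encY s y)))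
    (encY [::] (foldl g y s)).
Proof.
move=> hb.
apply: (evals_seq (u := DPair (DInt 0) (DPair E (encY [::] (foldl g y s))))).
  elim: s y => [|x s IH] y /=.
    have [t h] : evals O (PSeq PFst PIsPair) (DPair (DInt 0) (DPair E (encY [::] y))) (DInt 0).
      exact: evals_seq (evals_fst _ _ _) (evals_ispair _ _).
    by eexists; apply: exec_while_stop h.
  have [t1 h1] : evals O (PSeq PFst PIsPair)
      (DPair (dlist (map encX (x :: s))) (DPair E (encY (x :: s) y))) (DInt 1).
    exact: evals_seq (evals_fst _ _ _) (evals_ispair _ _).
  have [t2 h2] : evals O (p_fold_step body)
      (DPair (dlist (map encX (x :: s))) (DPair E (encY (x :: s) y)))
      (DPair (dlist (map encX s)) (DPair E (encY s (g y x)))).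
    apply: evals_fork.
      exact: evals_seq (evals_fst _ _ _) (evals_snd _ _ _).
    apply: evals_fork.
      exact: evals_seq (evals_snd _ _ _) (evals_fst _ _ _).
    apply: evals_seq (hb x s y); apply: evals_fork (evals_snd _ _ _).
    exact: evals_seq (evals_fst _ _ _) (evals_fst _ _ _).
  have [t3 h3] := IH (g y x).
  by eexists; apply: exec_while_loop h1 _ h2 h3.
exact: evals_seq (evals_snd _ _ _) (evals_snd _ _ _).
Qed.

Lemma evals_p_fold d (O : 'cV[int]_d -> 'cV[bool]_d) (X Y : Type)
    (encX : X -> datum) (encY : Y -> datum) (g : Y -> X -> Y) body E s y :
  (forall x y, evals O body (DPair (encX x) (DPair E (encY y))) (encY (g y x))) ->
  evals O (p_fold body) (DPair (dlist (map encX s)) (DPair E (encY y)))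
    (encY (foldl g y s)).
Proof.
by move=> hb; apply: (evals_p_fold_rest (encY := fun=> encY)) => x _; apply: hb.
Qed.

Lemma ptime_seq p q : ptime p -> ptime q -> ptime (PSeq p q).
Proof. by move=> tp tq; apply: ptime_seq_on tp tq _. Qed.

Lemma ptime_fork p q : ptime p -> ptime q -> ptime (PFork p q).
Proof. exact: ptime_fork_on. Qed.

Lemma ptime_if p q1 q2 : ptime p -> ptime q1 -> ptime q2 -> ptime (PIf p q1 q2).
Proof. exact: ptime_if_on. Qed.

Create HintDb ptime.
#[export] Hint Resolve ptime_id ptime_const ptime_fst ptime_snd ptime_ispair
  ptime_arith ptime_query ptime_seq ptime_fork ptime_if : ptime.

(* Runs straight-line code; [tac] handles the remaining instructions. *)
Ltac run_with tac :=
  lazymatch goal with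
  | |- evals _ PId _ _ => exact: evals_id
  | |- evals _ (PConst _) _ _ => exact: evals_const
  | |- evals _ PFst _ _ => exact: evals_fst
  | |- evals _ PSnd _ _ => exact: evals_snd
  | |- evals _ (PArith _) _ _ => exact: evals_arith
  | |- evals _ PQuery _ _ => exact: evals_query
  | |- evals _ (PSeq _ _) _ _ => eapply evals_seq; [run_with tac | run_with tac]
  | |- evals _ (PFork _ _) _ _ => eapply evals_fork; [run_with tac | run_with tac]
  | |- _ => tac
  end.

Ltac run := run_with ltac:(idtac; solve [eauto]).

(** * Reversing, mapping, zipping and summing lists *)

Definition p_rev : prog :=
  PSeq (PFork PId (PFork (PConst 0) (PConst 0)))
    (p_fold (PFork PFst (PSeq PSnd PSnd))).

Lemma evals_p_rev d (O : 'cV[int]_d -> 'cV[bool]_d) s :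
  evals O p_rev (dlist s) (dlist (rev s)).
Proof.
apply: evals_seq.
  by apply: evals_fork (evals_id _ _) (evals_fork (evals_const _ _ _) (evals_const _ _ _)).
have := @evals_p_fold d O _ _ id dlist (fun y x => x :: y) (PFork PFst (PSeq PSnd PSnd))
  (DInt 0) s [::].
rewrite map_id (_ : foldl _ _ _ = rev s); last first.
  by elim/last_ind: s => // s x IH; rewrite rev_rcons foldl_rcons IH.
by apply=> x y /=; run.
Qed.

Lemma ptime_p_rev : ptime p_rev.
Proof.
apply: ptime_seq; first by auto with ptime.
apply: (ptime_p_fold (G := 'X + 1%:P)) => [|d O x E A r]; first by auto with ptime.
move=> /evals_forkE[? [? [-> /evals_fstE[? [<- _]]]]].
move=> /evals_seqE[? /evals_sndE[? [_ <-]] /evals_sndE[? [_ <-]]] /=.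
by rewrite hornerS hornerX; lia.
Qed.

(** The fold conses its results and so reverses them, which the final [p_rev] repairs. [f] sees each
    element paired with a common environment. *)
Definition p_map f : prog :=
  PSeq (PSeq (PFork PFst (PFork PSnd (PConst 0)))
    (p_fold (PFork (PSeq (PFork PFst (PSeq PSnd PFst)) f) (PSeq PSnd PSnd)))) p_rev.

Lemma evals_p_map d (O : 'cV[int]_d -> 'cV[bool]_d) (X : Type) (F G : X -> datum)
    f E s :
  (forall x, evals O f (DPair (F x) E) (G x)) ->
  evals O (p_map f) (DPair (dlist (map F s)) E) (dlist (map G s)).
Proof.
move=> hf; rewrite -(revK (map G s)); apply: evals_seq (evals_p_rev _ _).
apply: evals_seq.
  exact: evals_fork (evals_fst _ _ _) (evals_fork (evals_snd _ _ _) (evals_const _ _ _)).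
rewrite (_ : rev _ = foldl (fun y x => G x :: y) [::] s).
  by apply: (@evals_p_fold _ _ _ _ F dlist _ _ E s [::]) => x y /=; run.
by elim/last_ind: s => // s x IH; rewrite map_rcons rev_rcons foldl_rcons IH.
Qed.

Lemma ptime_p_map f : ptime f -> ptime (p_map f).
Proof.
move=> tf; apply: ptime_seq ptime_p_rev; apply: ptime_seq; first by auto with ptime.
have [T fT] := tf.
(* [f] runs on a pair, one unit larger than its two components, and consing its result costs one
   more unit. *)
apply: (ptime_p_fold (G := T \Po ('X + 1%:P) + 1%:P)) => [|d O x E A r].
  by auto 10 with ptime.
move=> /evals_forkE[? [? [-> /evals_seqE[?]]]].
move=> /evals_forkE[? [? [-> /evals_fstE[? [<- _]]]]].
move=> /evals_seqE[? /evals_sndE[? [_ <-]] /evals_fstE[? [<- _]]] [t e].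
move=> /evals_seqE[? /evals_sndE[? [_ <-]] /evals_sndE[? [_ <-]]] /=.
rewrite horner_compS -addSn.
by have := fT _ _ _ _ _ I e; have := exec_size e; rewrite /= ; lia.
Qed.

(** The second list travels in the accumulator and loses its head in each round. The accumulator
    thus depends on the unread part of the first list, the case for which [evals_p_fold_rest] is
    stated. *)
Definition p_zip : prog :=
  let ys := PSeq PSnd (PSeq PSnd PFst) in
  PSeq (PSeq (PFork PFst (PFork (PConst 0) (PFork PSnd (PConst 0))))
    (PSeq (p_fold (PFork (PSeq ys PSnd)
                   (PFork (PFork PFst (PSeq ys PFst)) (PSeq PSnd (PSeq PSnd PSnd)))))
      PSnd)) p_rev.

Lemma evals_p_zip d (O : 'cV[int]_d -> 'cV[bool]_d) (X : Type) (F G : X -> datum) s :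
  evals O p_zip (DPair (dlist (map F s)) (dlist (map G s)))
    (dlist (map (fun x => DPair (F x) (G x)) s)).
Proof.
rewrite -(revK (map (fun x => DPair (F x) (G x)) s)); apply: evals_seq (evals_p_rev _ _).
apply: evals_seq.
  by apply: evals_fork (evals_fst _ _ _) (evals_fork (evals_const _ _ _)
    (evals_fork (evals_snd _ _ _) (evals_const _ _ _))).
rewrite (_ : rev _ = foldl (fun y x => DPair (F x) (G x) :: y) [::] s); last first.
  by elim/last_ind: s => // s x IH; rewrite map_rcons rev_rcons foldl_rcons IH.
apply: evals_seq.
  apply: (@evals_p_fold_rest _ _ _ _ F
    (fun s y => DPair (dlist (map G s)) (dlist y))
    (fun y x => DPair (F x) (G x) :: y) _ _ s [::]) => x s' y /=.
  by run.
exact: evals_snd.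
Qed.

Lemma ptime_p_zip : ptime p_zip.
Proof.
apply: ptime_seq ptime_p_rev; apply: ptime_seq; first by auto 10 with ptime.
apply: ptime_seq ptime_snd.
apply: (ptime_p_fold (G := 'X + 1%:P)) => [|d O x E A r].
  by auto 20 with ptime.
move=> /evals_forkE[A1 [B [-> /evals_seqE[ys /evals_seqE[C /evals_sndE[? [_ <-]]]]]]].
move=> /evals_seqE[A2 /evals_sndE[? [_ <-]] /evals_fstE[out ->]] /evals_sndE[y ->].
move=> /evals_forkE[xy [o [-> /evals_forkE[x2 [y2 [-> ]]]]]].
move=> /evals_fstE[? [<- _]] /evals_seqE[ys2 /evals_seqE[? /evals_sndE[? [_ <-]]]].
move=> /evals_seqE[? /evals_sndE[? [_ <-]] /evals_fstE[? [<- _]]].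
move=> /evals_fstE[? [<- _]].
move=> /evals_seqE[? /evals_sndE[? [_ <-]]].
move=> /evals_seqE[? /evals_sndE[? [_ <-]] /evals_sndE[? [_ <-]]] /=.
by rewrite hornerS hornerX; lia.
Qed.

Definition p_sum f : prog :=
  PSeq (PFork PId (PFork (PConst 0) (PConst 0)))
    (p_fold (PSeq (PFork (PSeq PSnd PSnd) (PSeq PFst f)) (PArith OpAdd))).

Lemma evals_p_sum d (O : 'cV[int]_d -> 'cV[bool]_d) (X : Type) (F : X -> datum)
    (h : X -> int) f s :
  (forall x, evals O f (F x) (DInt (h x))) ->
  evals O (p_sum f) (dlist (map F s)) (DInt (\sum_(x <- s) h x)).
Proof.
move=> hf; apply: evals_seq.
  exact: evals_fork (evals_id _ _) (evals_fork (evals_const _ _ _) (evals_const _ _ _)).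
rewrite (_ : \sum_(x <- s) h x = foldl (fun y x => y + h x) 0 s).
  apply: (@evals_p_fold _ _ _ _ F DInt (fun y x => y + h x)) => x y.
  apply: evals_seq; last exact: evals_arith.
  by run.
elim/last_ind: s => [|s x IH]; first by rewrite big_nil.
by rewrite -cats1 big_cat big_seq1 /= foldl_cat /= IH.
Qed.

Lemma ptime_p_sum f : ptime f -> ptime (p_sum f).
Proof.
move=> tf; apply: ptime_seq; first by auto with ptime.
have [T fT] := tf.
apply: (ptime_p_fold (G := T)) => [|d O x E A r].
  by auto 10 with ptime.
move=> /evals_seqE[? /evals_forkE[a [b [-> /evals_seqE[?]]]]].
move=> /evals_sndE[? [_ <-]] /evals_sndE[? [_ <-]].
move=> /evals_seqE[? /evals_fstE[? [<- _]] [t e]].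
move=> /evals_arithE[i [j [[-> bE] ->]]].
move: e; rewrite {}bE => e.
have h1 := fT _ _ _ _ _ I e; have h2 := exec_size e.
have h3 := @leq_horner T (datum_size x) (datum_size x + datum_size E) (leq_addr _ _).
have := int_sizeD i j; rewrite /= in h2 *; lia.
Qed.

#[export] Hint Resolve ptime_p_rev ptime_p_map ptime_p_zip ptime_p_sum : ptime.

(** * Greedy covering by blocks of equal columns *)

Definition count_row d n (y : 'M[bool]_(d, n)) (i : 'I_d) : nat :=
  (\sum_(j < n) y i j)%N.

Definition prefix_sum d n (c : 'M[int]_(d, n)) (i : 'I_d) (m : nat) : int :=
  \sum_(j < n | (j < m)%N) c i j.

Lemma count_row_le d n (y : 'M[bool]_(d, n)) i : (count_row y i <= n)%N.
Proof.
rewrite -[X in (_ <= X)%N]card_ord -sum1_card; apply: leq_sum => j _.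
exact: leq_b1.
Qed.

Lemma sorted_ones_zeros k l : sorted >=%R (nseq k (1 : int) ++ nseq l 0).
Proof.
have zeros (x : int) : 0 <= x -> path >=%R x (nseq l 0).
  by elim: l x => //= l IH x ->; apply: IH.
case: k => [|k] /=; first by case: l zeros => //= l h; have := h 0 (lexx 0); case/andP.
by elim: k => [|k IH] //=; apply: zeros.
Qed.

(** A sorted list is determined by its multiset, and a 0/1 row has the multiset of its ones followed
    by its zeros. *)
Lemma shift_intmx d n (y : 'M[bool]_(d, n)) i j :
  shift (intmx y) i j = (j < count_row y i)%N%:Z.
Proof.
rewrite mxE; set s := [seq _ | _ <- _].
have -> : sort >=%R s = nseq (count_row y i) 1 ++ nseq (n - count_row y i) 0.
  apply: (@sorted_eq _ >=%R).
  - exact: ge_trans.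
  - exact: ge_anti.
  - by apply: sort_sorted => a b; apply: le_total.
  - exact: sorted_ones_zeros.
  rewrite perm_sort; apply/permP => a; rewrite count_cat !count_nseq.
  rewrite /s count_map -sum1_count big_enum_cond /=.
  have -> : (\sum_(k < n | a (intmx y i k)) 1 =
      \sum_(k < n) (a 1 * y i k + a 0%Z * ~~ y i k))%N.
    rewrite big_mkcond; apply: eq_bigr => k _; rewrite mxE.
    by case: (y i k); rewrite /= ?muln0 ?muln1 ?addn0 ?add0n; case: (a _).
  rewrite big_split /= -!big_distrr /=; congr (_ * _ + _ * _)%N.
  rewrite -[n in (n - _)%N]card_ord -sum1_card /count_row.
  apply/eqP; rewrite -(eqn_add2r (\sum_(j < n) y i j)%N) subnK; last first.
    by apply: leq_sum => k _; apply: leq_b1.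
  by rewrite -big_split /=; apply/eqP; apply: eq_bigr => k _; case: (y i k).
rewrite nth_cat size_nseq nth_nseq.
by case: ltnP => // _; rewrite nth_nseq; case: ifP.
Qed.

Lemma mxdot_shift d n (c : 'M[int]_(d, n)) (y : 'M[bool]_(d, n)) :
  mxdot c (shift (intmx y)) = \sum_i prefix_sum c i (count_row y i).
Proof.
apply: eq_bigr => i _; rewrite /prefix_sum [RHS]big_mkcond; apply: eq_bigr => j _.
by rewrite shift_intmx; case: ltnP; rewrite ?mulr1 ?mulr0.
Qed.

(** Division-free form of (1 - p / (2n))^g <= 3/4. With N = 2n - p, the hypothesis n < (g + 1) p
    gives N <= 3 g p, so Bernoulli's (N + p)^g >= N^g + g p N^(g - 1) is at least 4/3 N^g. *)
Lemma bernoulli_block (n p g : nat) : (0 < p)%N -> (p <= n)%N -> (n < g.+1 * p)%N ->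
  (4 * (n.*2 - p) ^ g <= 3 * n.*2 ^ g)%N.
Proof.
move=> p0 pn ng.
have -> : n.*2 = ((n.*2 - p) + p)%N by lia.
rewrite addnK; set N := (n.*2 - p)%N.
(* For g = 0 the hypotheses would give both n < p and p <= n. *)
case: g ng => [|g] ng; first lia.
have h : (N ^ g.+1 + g.+1 * p * N ^ g <= (N + p) ^ g.+1)%N.
  elim: (g) => [|k IH]; first by rewrite !expn1 expn0; lia.
  rewrite (expnS (N + p)); apply: leq_trans (leq_mul (leqnn _) IH).
  rewrite [(N ^ k.+2)%N]expnS [(N ^ k.+1)%N]expnS; nia.
have h2 : (N <= 3 * (g.+1 * p))%N by rewrite /N; nia.
have h3 := leq_mul h2 (leqnn (N ^ g)%N).
rewrite -expnS in h3; lia.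
Qed.

(** In (a, (b, m)), b is the current weight and m the count attaining it. The scan keeps the prefix
    sum of the row in a; a block run resets a and stores there the number of ones still owed to the
    row. *)
Definition rows d : Type := 'I_d -> int * (int * int).

Section Blocks.
Variables (d : nat) (O : 'cV[int]_d -> 'cV[bool]_d).

Definition weights (R : rows d) : 'cV[int]_d := \col_i (R i).2.1.

Definition start_block (s : 'cV[bool]_d) (R : rows d) : rows d :=
  fun i => if s i 0 then ((R i).2.2, (0, 0)) else R i.

Definition emit (R : rows d) : 'cV[bool]_d := \col_i (1 <= (R i).1).

Definition pay (R : rows d) : rows d :=
  fun i => ((R i).1 - (1 <= (R i).1)%R%:Z, (R i).2).

(** In ((t, j), (R, out)), t columns remain in the current block and j overall; [out] lists the
    emitted columns, latest first. On idle columns after the last block t becomes negative. *)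
Definition block_state : Type := (int * int) * (rows d * seq 'cV[bool]_d).

Definition maybe_start (p : int) (st : block_state) : block_state :=
  if (st.1.1 <= 0) && (p <= st.1.2)
  then ((p, st.1.2), (start_block (O (weights st.2.1)) st.2.1, st.2.2)) else st.

Definition emit_column (st : block_state) : block_state :=
  ((st.1.1 - 1, st.1.2 - 1), (pay st.2.1, emit st.2.1 :: st.2.2)).

Definition block_step p st := emit_column (maybe_start p st).

Definition run_blocks (n : nat) (p : int) (R : rows d) : block_state :=
  iter n (block_step p) ((0, n%:Z), (fun i => (0, (R i).2), [::])).

End Blocks.

Section BlockInvariant.
Variables (d : nat) (S : {set 'cV[bool]_d}) (O : 'cV[int]_d -> 'cV[bool]_d).
Variables (n p : nat) (b0 : 'I_d -> int) (m0 : 'I_d -> nat).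
Hypotheses (indS : independence_system S) (optO : lin_opt_oracle S O).
Hypotheses (p_gt0 : (0 < p)%N) (le_pn : (p <= n)%N).
Hypotheses (b0_ge0 : forall i, 0 <= b0 i) (m0_le : forall i, (m0 i <= p)%N).

Let taken (out : seq 'cV[bool]_d) (i : 'I_d) : nat :=
  (\sum_(x <- out) (x : 'cV_d) i 0%R)%N.

(** Rows with more than p ones are included: the bound p on the count matters only when [b0] is
    compared with a prefix sum of c. *)
Let total (z : 'M[bool]_(d, n)) : int :=
  \sum_(i < d | (p <= (count_row z i).*2)%N) b0 i.

Let gain (R : rows d) : int := \sum_(i < d) (b0 i - (R i).2.1).

(** [inv_debt] and [inv_fits] make every block finish with all debts paid, so that a covered row
    gets exactly [m0 i] ones. In [inv_gain], g is the number of blocks opened: either no further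
    block would fit into n columns, or no column has been idle. Its inequality says that [gain]
    leaves at most the fraction (1 - p / (2n))^g of [total z]. *)
Record block_inv (k : nat) (st : block_state d) : Prop := BlockInv {
  inv_left : st.1.2 = n%:Z - k%:Z;
  inv_size : size st.2.2 = k;
  inv_sets : forall x, x \in st.2.2 -> x \in S;
  inv_active : exists2 s, s \in S & forall i, 0 < (st.2.1 i).1 -> (s : 'cV_d) i 0;
  inv_debt : forall i, 0 <= (st.2.1 i).1 /\ (0 < (st.2.1 i).1 -> (st.2.1 i).1 <= st.1.1);
  inv_row : forall i,
    [/\ (st.2.1 i).2 = (b0 i, (m0 i)%:Z), (st.2.1 i).1 = 0 & taken st.2.2 i = 0%N] \/
    (st.2.1 i).2 = (0, 0) /\ (taken st.2.2 i)%:Z + (st.2.1 i).1 = (m0 i)%:Z;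
  inv_fits : st.1.1 <= st.1.2;
  inv_gain : exists g : nat,
    ((n < g.+1 * p)%N \/ 0 <= st.1.1 /\ (g * p)%N%:Z = k%:Z + st.1.1) /\
    forall z, in_power S z ->
      (n.*2%:Z) ^+ g * (total z - gain st.2.1) <= (n.*2%:Z - p%:Z) ^+ g * total z }.

Lemma mxdot_cV (w : 'cV[int]_d) (s : 'cV[bool]_d) :
  mxdot w (intmx s) = \sum_(i < d) w i 0 * (s i 0)%:Z.
Proof. by apply: eq_bigr => i _; rewrite big_ord1 mxE. Qed.

(** Every column of z lies in S and so weighs at most the oracle answer; summing over the n columns
    counts each row as often as it has ones. *)
Lemma oracle_average (w : 'cV[int]_d) (z : 'M[bool]_(d, n)) : in_power S z ->
  \sum_(i < d) w i 0 * (count_row z i)%:Z <= n%:Z * mxdot w (intmx (O w)).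
Proof.
move=> Sz; have [_ h] := optO w.
have -> : n%:Z * mxdot w (intmx (O w)) = \sum_(j < n) mxdot w (intmx (O w)).
  by rewrite sumr_const card_ord -mulr_natl natz.
have -> : \sum_(i < d) w i 0 * (count_row z i)%:Z =
    \sum_(j < n) mxdot w (intmx (col j z)).
  under [RHS]eq_bigr => j _ do rewrite mxdot_cV.
  rewrite exchange_big; apply: eq_bigr => i _ /=.
  rewrite -mulr_sumr; congr (_ * _).
  by rewrite /count_row -natz natr_sum; apply: eq_bigr => j _; rewrite mxE natz.
by apply: ler_sum => j _; apply: h.
Qed.

Lemma block_inv_start k st : block_inv k st ->
  block_inv k (maybe_start O p st).
Proof.
case: st => [[t j] [R out]]; rewrite /maybe_start /=; case: ifP => // /andP[t0 pj].
case=> /= jE sz sets _ debt row fits [g [gp ratio]].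
have r0 i : (R i).1 = 0.
  by have [h1 h2] := debt i; apply/eqP; rewrite eq_le h1 andbT leNgt; apply/negP => h3;
    have := h2 h3; lia.
have bR i : 0 <= (R i).2.1 <= b0 i.
  by have := b0_ge0 i; case: (row i) => [[-> _ _]|[-> _]] /= ->; rewrite ?lexx.
have [sS _] := optO (weights R); set s := O _ in sS *.
split=> //=.
- by exists s => // i; rewrite /start_block; case: ifP => // _; rewrite r0.
- move=> i; rewrite /start_block; case: ifP => _ /=; last by rewrite r0.
  have := m0_le i; case: (row i) => [[-> _ _]|[-> _]] /=; lia.
(* A row may be covered a second time; its stored count is then 0, so no further ones are owed. *)
- move=> i; rewrite /start_block; case: ifP => _ //=; right; split=> //.
  by case: (row i) => [[-> _ ->]|[-> /=]] //=; rewrite r0.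
exists g.+1; split.
  by case: gp => [h|[h1 h2]]; [left|right]; rewrite ?mulSn; lia.
move=> z Sz.
have -> : gain (start_block s R) = gain R + mxdot (weights R) (intmx s).
  rewrite /gain mxdot_cV -big_split /=; apply: eq_bigr => i _.
  by rewrite /start_block !mxE; case: (s i 0) => /=; lia.
(* The rows of [total z] still carry weight at least [total z - gain R], and each has p <= 2 times
   its count, so the averaging bound applies. *)
have h1 : p%:Z * (total z - gain R) <= 2 * (n%:Z * mxdot (weights R) (intmx s)).
  apply: le_trans (ler_wpM2l _ (oracle_average (weights R) Sz)) => //.
  apply: (@le_trans _ _ (p%:Z * \sum_(i < d | (p <= (count_row z i).*2)%N) (R i).2.1)).
    apply: ler_wpM2l => //; rewrite lerBlDr -lerBlDl /total -sumrB /gain.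
    rewrite big_mkcond; apply: ler_sum => i _; have := bR i.
    by case: ifP => _; lia.
  rewrite mulr_sumr [X in _ <= X]mulr_sumr big_mkcond; apply: ler_sum => i _ /=.
  rewrite mxE; have := bR i; case: ifP => h; nia.
have h2 := ratio z Sz.
have h3 : 0 <= n.*2%:Z ^+ g :> int by rewrite exprn_ge0.
have h4 : n.*2%:Z = 2 * n%:Z by rewrite -muln2 PoszM mulrC.
have h5 : 0 <= n.*2%:Z - p%:Z by lia.
rewrite !exprS.
have h6 := ler_wpM2l h5 h2.
have h7 := ler_wpM2l h3 h1.
move: h6 h7.
set X := _ ^+ g; set Y := _ ^+ g; set D := mxdot _ _; set A := total z.
set G := gain R; rewrite h4; move: (n%:Z) (p%:Z) => N q h6 h7.
(* The slack splits into the old estimate multiplied by 2n - p and the averaging estimate multiplied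
   by (2n)^g. *)
rewrite -subr_ge0 (_ : _ - _ =
  ((2 * N - q) * (Y * A) - (2 * N - q) * (X * (A - G))) +
  (X * (2 * (N * D)) - X * (q * (A - G)))); last by ring.
by rewrite addr_ge0 ?subr_ge0.
Qed.

Lemma block_inv_emit k st : (k < n)%N -> block_inv k st ->
  0 < st.1.1 \/ st.1.2 < p%:Z ->
  block_inv k.+1 (emit_column st).
Proof.
case: st => [[t j] [R out]] kn [/= jE sz sets [s sS active] debt row fits [g [gp ratio]]] tj.
rewrite /emit_column; split=> /=.
- lia.
- by rewrite sz.
- move=> x; rewrite in_cons => /orP[/eqP->|/sets//].
  apply: indS.2 sS _ => i; rewrite mxE.
  by case: (boolP (1 <= (R i).1)) => // h; rewrite active //; lia.
- by exists s => // i; rewrite /pay /= => h; apply: active; lia.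
- by move=> i; rewrite /pay /=; have [h1 h2] := debt i; split; [lia|move=> h3; lia].
- move=> i; rewrite /pay /= /taken big_cons mxE -/(taken out i).
  case: (row i) => [[-> -> ->]|[-> h]]; [left|right] => //; split=> //.
  by rewrite -h; lia.
- lia.
exists g; split=> //.
case: gp => [h|[h1 h2]]; first by left.
case: tj => h; first by right; lia.
(* Fewer than p columns remain. If also t = 0, then g p = k and n - k < p, so n < (g + 1) p from
   here on. *)
case: (ltP 0 t) => h3; first by right; lia.
by left; rewrite mulSn; lia.
Qed.

Lemma block_inv_step k st : (k < n)%N -> block_inv k st ->
  block_inv k.+1 (block_step O p st).
Proof.
move=> kn inv; apply: block_inv_emit => //; first exact: block_inv_start.
rewrite /maybe_start; case: ifP => /= h; first by left.
by move: h; lia.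
Qed.

Variable R0 : rows d.
Hypothesis R0E : forall i, (R0 i).2 = (b0 i, (m0 i)%:Z).

Lemma run_blocks_inv : block_inv n (run_blocks O n p R0).
Proof.
suff h k : (k <= n)%N -> block_inv k
    (iter k (block_step O p) ((0, n%:Z), (fun i => (0, (R0 i).2), [::]))).
  exact: h.
elim: k => [_|k IH kn]; last by rewrite iterS; apply: block_inv_step => //; apply/IH/ltnW.
split=> //=.
- by rewrite subr0.
- by exists (const_mx false) => //; case: indS.
- by move=> i; left; rewrite R0E /taken big_nil.
exists 0%N; split; first by right.
move=> z _; rewrite !expr0 !mul1r gerBl; apply: sumr_ge0 => i _.
by rewrite R0E subrr.
Qed.

Lemma run_blocksP : exists y : 'M[bool]_(d, n),
  [/\ in_power S y, (run_blocks O n p R0).2.2 = [seq col j y | j <- enum 'I_n],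
      forall i, (count_row y i = 0%N /\ ((run_blocks O n p R0).2.1 i).2.1 = b0 i) \/
                (count_row y i = m0 i /\ ((run_blocks O n p R0).2.1 i).2.1 = 0)
    & forall z : 'M[bool]_(d, n), in_power S z ->
        \sum_(i < d | (p <= (count_row z i).*2)%N) b0 i <=
        4 * \sum_(i < d) (b0 i - ((run_blocks O n p R0).2.1 i).2.1)].
Proof.
case: run_blocks run_blocks_inv => [[t j] [R out]] [/= jE sz sets _ debt row fits [g [gp ratio]]].
pose y : 'M[bool]_(d, n) := \matrix_(i, j) (nth (const_mx false) out j : 'cV_d) i 0.
have colE (k : 'I_n) : col k y = nth (const_mx false) out k.
  by apply/matrixP => i l; rewrite !mxE ord1.
have outE : out = [seq col j y | j <- enum 'I_n].
  rewrite (eq_map colE) (map_comp (nth (const_mx false) out) val) val_enum_ord -sz.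
  exact/esym/mkseq_nth.
have takenE i : taken out i = count_row y i.
  rewrite /taken {1}outE big_map big_enum /=; apply: eq_bigr => k _.
  by rewrite !mxE.
(* At the end j = 0, hence t <= 0, and a positive debt would be at most t. *)
have r0 i : (R i).1 = 0.
  have [h1 h2] := debt i; apply/eqP; rewrite eq_le h1 andbT leNgt; apply/negP => h3.
  by have := h2 h3; lia.
exists y; split=> //.
- by move=> k; rewrite colE; apply/sets/mem_nth; rewrite sz.
- move=> i; case: (row i) => [[-> _ h]|[-> h]]; [left|right]; split=> //.
    by rewrite -takenE.
  by move: h; rewrite r0 takenE; lia.
move=> z Sz; have h1 := ratio z Sz.
have ng : (n < g.+1 * p)%N by case: gp => // -[h2 h3]; rewrite mulSn; lia.
have := bernoulli_block p_gt0 le_pn ng.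
rewrite -lez_nat !PoszM -!natz !natrX !natz -subzn; last by lia.
have A0 : 0 <= total z by apply: sumr_ge0.
have N0 : 0 < (n.*2%:Z) ^+ g :> int by rewrite exprn_gt0 //; lia.
rewrite -/(total z) -/(gain R) => h2.
have h3 := ler_wpM2r A0 h2.
rewrite -(ler_pM2l N0); nia.
Qed.

End BlockInvariant.

(** * Scanning the block lengths p = 1, ..., n *)

Section Scan.
Variables (d : nat) (O : 'cV[int]_d -> 'cV[bool]_d) (n : nat).

Definition update_row (p : int) (x : int * (int * int)) (e : int) :
    int * (int * int) :=
  let a := x.1 + e in if a <= x.2.1 then (a, x.2) else (a, (a, p)).

Definition scan_state : Type := (int * rows d) * (int * seq 'cV[bool]_d).

(** Covered rows have exactly m_i ones and the others none, so the weight removed by a block run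
    equals the objective value of the emitted matrix. The program therefore never sorts a row. *)
Definition saved (R R' : rows d) : int :=
  \sum_(i <- enum 'I_d) (R i).2.1 - \sum_(i <- enum 'I_d) (R' i).2.1.

(** The p-th column of c extends the prefix sums to length p, which is also the block length tried,
    so one pass over c maintains the row maxima over [0, p]. *)
Definition scan_step (st : scan_state) (e : 'cV[int]_d) : scan_state :=
  let p := st.1.1 + 1 in
  let R : rows d := fun i => update_row p (st.1.2 i) (e i 0) in
  let res := (run_blocks O n p R).2 in
  ((p, R),
   if saved R res.1 <= st.2.1 then st.2 else (saved R res.1, res.2)).

Definition scan (s : seq 'cV[int]_d) : scan_state :=
  foldl scan_step ((0, fun=> (0, (0, 0))), (0, nseq n (const_mx false))) s.

End Scan.

Section ScanInvariant.
Variables (d n : nat) (S : {set 'cV[bool]_d}) (O : 'cV[int]_d -> 'cV[bool]_d).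
Variable c : 'M[int]_(d, n).
Hypotheses (indS : independence_system S) (optO : lin_opt_oracle S O).

(** The predicate [Q] in [inv_ratio] is there because the classes of rows formed by logarithms can
    be smaller than the whole range from p / 2 to p; restricting to them is harmless since the
    maxima over [0, p] are nonnegative. *)
Record scan_inv (k : nat) (st : scan_state d) : Prop := ScanInv {
  inv_index : st.1.1 = k%:Z;
  inv_prefix : forall i, (st.1.2 i).1 = prefix_sum c i k;
  inv_best : forall i, exists m : nat, [/\ (st.1.2 i).2 = (prefix_sum c i m, m%:Z),
    (m <= k)%N & forall m', (m' <= k)%N -> prefix_sum c i m' <= prefix_sum c i m];
  inv_ge0 : 0 <= st.2.1;
  inv_sol : exists y : 'M[bool]_(d, n),
    [/\ in_power S y, st.2.2 = [seq col j y | j <- enum 'I_n]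
      & st.2.1 = mxdot c (shift (intmx y))];
  inv_ratio : forall p, (0 < p)%N -> (p <= k)%N ->
    forall z : 'M[bool]_(d, n), in_power S z -> forall Q : pred 'I_d,
      (forall i, Q i -> (count_row z i <= p)%N && (p <= (count_row z i).*2)%N) ->
      \sum_(i < d | Q i) prefix_sum c i (count_row z i) <= 4 * st.2.1 }.

Lemma prefix_sum0 i : prefix_sum c i 0 = 0.
Proof. by rewrite /prefix_sum big_pred0_eq. Qed.

Lemma prefix_sumS i (k : 'I_n) : prefix_sum c i k.+1 = prefix_sum c i k + c i k.
Proof.
rewrite /prefix_sum (bigD1 k) //= addrC; congr (_ + _).
by apply: eq_bigl => j; rewrite ltnS [RHS]ltn_neqAle andbC.
Qed.

Lemma scan_inv_step (k : 'I_n) st : scan_inv k st ->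
  scan_inv k.+1 (scan_step O n st (col k c)).
Proof.
case: st => [[p R] [v sol]] [/= pE aE best v0 [y [Sy solE vE]] ratio].
rewrite /scan_step /= pE; set p' := (k%:Z + 1).
have p'E : p' = k.+1%:Z by rewrite /p' -addn1 PoszD.
set R' : rows d := fun i => _; set res := (run_blocks _ _ _ _).2.
have aE' i : (R' i).1 = prefix_sum c i k.+1.
  by rewrite prefix_sumS -aE /R' /update_row mxE; case: ifP.
have best' i : exists m : nat, [/\ (R' i).2 = (prefix_sum c i m, m%:Z),
    (m <= k.+1)%N & forall m', (m' <= k.+1)%N -> prefix_sum c i m' <= prefix_sum c i m].
  have := aE' i; have [m [mE mk hm]] := best i.
  rewrite /R' /update_row mE /= mxE; case: ifP => /= h h'.
    exists m; split=> //; first exact: leqW.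
    by move=> m'; rewrite leq_eqVlt => /predU1P[->|]; rewrite -?h' // ltnS; apply: hm.
  exists k.+1; rewrite h' p'E; split=> // m'.
  rewrite leq_eqVlt => /predU1P[->//|]; rewrite ltnS => /hm h2.
  by rewrite -h'; lia.
(* The stored pair determines the count, so any count matching it inherits maximality; this makes
   [xchoose] on a decidable equation suffice. *)
have {best'} [m0 m0P] : exists m0 : 'I_d -> nat, forall i, [/\ (R' i).2 = (prefix_sum c i (m0 i), (m0 i)%:Z),
    (m0 i <= k.+1)%N & forall m', (m' <= k.+1)%N -> prefix_sum c i m' <= prefix_sum c i (m0 i)].
  pose P i (m : nat) := ((R' i).2 == (prefix_sum c i m, m%:Z)).
  have exm i : exists m, P i m by have [m [h _ _]] := best' i; exists m; apply/eqP.
  exists (fun i => xchoose (exm i)) => i; have /eqP h := xchooseP (exm i).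
  by have [m [mE mk hm]] := best' i; move: h; rewrite mE => -[_ <-].
pose b0 i := prefix_sum c i (m0 i).
have b0_ge0 i : 0 <= b0 i.
  by have [_ _ h] := m0P i; rewrite -(prefix_sum0 i); apply: h.
have m0_le i : (m0 i <= k.+1)%N by have [] := m0P i.
have R'E i : (R' i).2 = (b0 i, (m0 i)%:Z) by have [] := m0P i.
have [y' [Sy' outE rowE gainE]] :=
  run_blocksP indS optO (ltn0Sn k) (ltn_ord k) b0_ge0 m0_le R'E.
rewrite -/R' -p'E -/res in outE rowE gainE.
have savedE : saved R' res.1 = \sum_i (b0 i - (res.1 i).2.1).
  by rewrite /saved !big_enum -sumrB; apply: eq_bigr => i _; rewrite R'E.
have valE : saved R' res.1 = mxdot c (shift (intmx y')).
  rewrite savedE mxdot_shift; apply: eq_bigr => i _.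
  case: (rowE i) => -[-> ->]; first by rewrite subrr prefix_sum0.
  by rewrite subr0.
have le_new p0 : (p0 <= k.+1)%N -> forall z : 'M[bool]_(d, n), in_power S z ->
    forall Q : pred 'I_d,
    (forall i, Q i -> (count_row z i <= p0)%N && (p0 <= (count_row z i).*2)%N) ->
    p0 = k.+1 ->
    \sum_(i < d | Q i) prefix_sum c i (count_row z i) <= 4 * saved R' res.1.
  move=> p0k z Sz Q hQ p0E; rewrite savedE; apply: le_trans (gainE z Sz).
  apply: (@le_trans _ _ (\sum_(i < d | Q i) b0 i)).
    apply: ler_sum => i /hQ /andP[h _]; have [_ _ hm] := m0P i.
    by apply: hm; apply: leq_trans h p0k.
  rewrite [X in X <= _]big_mkcond [X in _ <= X]big_mkcond; apply: ler_sum => i _.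
  case: ifP => [/hQ/andP[_]|_]; first by rewrite p0E => ->.
  by case: ifP.
have le_old p0 : (0 < p0)%N -> (p0 < k.+1)%N -> forall z : 'M[bool]_(d, n),
    in_power S z -> forall Q : pred 'I_d,
    (forall i, Q i -> (count_row z i <= p0)%N && (p0 <= (count_row z i).*2)%N) ->
    \sum_(i < d | Q i) prefix_sum c i (count_row z i) <= 4 * v.
  by rewrite /= => p00 p0k; apply: ratio.
split=> //=.
- by move=> i; exists (m0 i).
- by case: ifP => //=; lia.
- by case: ifP => _; [exists y | exists y'].
move=> p0 p00 p0k z Sz Q hQ; have := p0k; rewrite leq_eqVlt => /predU1P[p0E|h].
  have := le_new _ p0k z Sz Q hQ p0E; case: ifP => //= h1 h2.
  by apply: le_trans h2 _; rewrite ler_pM2l.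
have := le_old _ p00 h z Sz Q hQ; case: ifP => //= h1 h2.
by apply: le_trans h2 _; rewrite ler_pM2l //; lia.
Qed.

Lemma scanP : scan_inv n (scan O n [seq col j c | j <- enum 'I_n]).
Proof.
suff h k : (k <= n)%N ->
    scan_inv k (scan O n (take k [seq col j c | j <- enum 'I_n])).
  by have := h n (leqnn n); rewrite take_oversize // size_map size_enum_ord.
elim: k => [_|k IH kn].
  rewrite take0 /scan /=; split=> //=.
  - by move=> i; rewrite prefix_sum0.
  - move=> i; exists 0%N; split; rewrite ?prefix_sum0 // => m.
    by rewrite leqn0 => /eqP->; rewrite prefix_sum0.
  - exists (const_mx false); split.
    + by move=> j; have -> : col j (const_mx false) = const_mx false :> 'cV[bool]_d;
        [apply/matrixP => a b; rewrite !mxE | case: indS].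
    + have -> : [seq col j (const_mx false) | j <- enum 'I_n] =
          [seq const_mx false | j <- enum 'I_n] :> seq 'cV[bool]_d.
        by apply: eq_map => j; apply/matrixP => a b; rewrite !mxE.
      by rewrite -[X in nseq X _](size_enum_ord n); elim: (enum _) => //= a l ->.
    + rewrite mxdot_shift big1 // => i _; rewrite /count_row big1 ?prefix_sum0 // => j _.
      by rewrite mxE.
  by move=> p; case: p.
have ks : (k < size [seq col j c | j <- enum 'I_n])%N by rewrite size_map size_enum_ord.
rewrite (take_nth 0 ks).
rewrite (nth_map (Ordinal kn)); last by rewrite size_enum_ord.
rewrite /scan foldl_rcons (_ : nth _ _ _ = Ordinal kn); last first.
  by apply: val_inj; rewrite /= nth_enum_ord.
exact: (@scan_inv_step (Ordinal kn) _ (IH (ltnW kn))).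
Qed.

Lemma scan_ratio (z : 'M[bool]_(d, n)) : (0 < n)%N -> in_power S z ->
  mxdot c (shift (intmx z)) <=
    (4 * (up_log 2 n).+1)%N%:Z * (scan O n [seq col j c | j <- enum 'I_n]).2.1.
Proof.
move=> n0 Sz; have [_ _ _ v0 _ ratio] := scanP.
set v := (scan _ _ _).2.1 in v0 ratio *.
rewrite mxdot_shift (bigID (fun i => 0 < count_row z i)%N) /=.
rewrite [X in _ + X]big1 ?addr0; last first.
  by move=> i; rewrite -leqNgt leqn0 => /eqP->; rewrite prefix_sum0.
set L := up_log 2 n.
(* Counts are at most n, so their logarithms lie in 0, ..., L: there are L + 1 classes, each worth
   at most 4 v. *)
rewrite (partition_big (fun i => inord (up_log 2 (count_row z i)) : 'I_L.+1) xpredT) //=.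
have -> : (4 * L.+1)%N%:Z * v = \sum_(k < L.+1) 4 * v.
  by rewrite sumr_const card_ord -mulr_natl natz PoszM; ring.
apply: ler_sum => k _.
(* Counts in class k lie above 2^(k - 1) and are at most 2^k; the minimum with n keeps p among the
   lengths tried. *)
apply: (ratio (minn (2 ^ k) n)) => //.
- by rewrite leq_min n0 expn_gt0.
- exact: geq_minr.
move=> i /andP[ci0 /eqP kE].
have kE' : up_log 2 (count_row z i) = k.
  by rewrite -kE inordK // ltnS leq_up_log // count_row_le.
have h1 := @up_logP 2 (count_row z i) isT; rewrite kE' in h1.
rewrite leq_min h1 count_row_le /= geq_min; apply/orP; left.
have [c1|c1] := leqP (count_row z i) 1.
  have : count_row z i = 1%N by lia.
  by move=> c1'; rewrite -kE' c1' up_log1.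
have := @up_log_gtn 2 _ isT c1; rewrite kE'.
by case: (k : nat) kE' => [|k'] /= _; rewrite ?expnS; lia.
Qed.

End ScanInvariant.

(** * The program *)

Definition enc_row (x : int * (int * int)) : datum :=
  DPair (DInt x.1) (DPair (DInt x.2.1) (DInt x.2.2)).

Definition enc_rows d (R : rows d) : datum := dvec (fun i => enc_row (R i)).

Definition enc_cols d (out : seq 'cV[bool]_d) : datum :=
  dlist [seq enc_vec (intmx x) | x <- out].

Definition enc_block d (st : block_state d) : datum :=
  DPair (DPair (DInt st.1.1) (DInt st.1.2))
    (DPair (enc_rows st.2.1) (enc_cols st.2.2)).

Definition enc_scan d (st : scan_state d) : datum :=
  DPair (DPair (DInt st.1.1) (enc_rows st.1.2))
    (DPair (DInt st.2.1) (enc_cols st.2.2)).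

Definition p_arith o p q : prog := PSeq (PFork p q) (PArith o).

Definition p_weights : prog :=
  PSeq (PFork PId (PConst 0)) (p_map (PSeq PFst (PSeq PSnd PFst))).

Definition p_start_block : prog :=
  PSeq p_zip (PSeq (PFork PId (PConst 0))
    (p_map (PIf (PSeq PFst PFst)
             (PFork (PSeq PFst (PSeq PSnd (PSeq PSnd PSnd)))
                    (PFork (PConst 0) (PConst 0)))
             (PSeq PFst PSnd)))).

Definition p_bit : prog := p_arith OpLe (PConst 1) (PSeq PFst PFst).

Definition p_emit : prog := PSeq (PFork PId (PConst 0)) (p_map p_bit).

Definition p_pay : prog :=
  PSeq (PFork PId (PConst 0))
    (p_map (PFork (p_arith OpSub (PSeq PFst PFst) p_bit) (PSeq PFst PSnd))).

(* Input (unused list element, (p, block state)). *)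
Definition p_block_step : prog :=
  let p := PSeq PSnd PFst in
  let st := PSeq PSnd PSnd in
  let t := PSeq st (PSeq PFst PFst) in
  let j := PSeq st (PSeq PFst PSnd) in
  let R := PSeq st (PSeq PSnd PFst) in
  let out := PSeq st (PSeq PSnd PSnd) in
  PSeq
    (PIf (p_arith OpMul (p_arith OpLe t (PConst 0)) (p_arith OpLe p j))
       (PFork (PFork p j)
          (PFork (PSeq (PFork (PSeq (PSeq R p_weights) PQuery) R) p_start_block) out))
       st)
    (PFork (PFork (p_arith OpSub (PSeq PFst PFst) (PConst 1))
                  (p_arith OpSub (PSeq PFst PSnd) (PConst 1)))
       (PFork (PSeq (PSeq PSnd PFst) p_pay)
          (PFork (PSeq (PSeq PSnd PFst) p_emit) (PSeq PSnd PSnd)))).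

Definition p_update_rows : prog :=
  let a := p_arith OpAdd (PSeq PFst (PSeq PSnd PFst)) (PSeq PFst PFst) in
  let bm := PSeq PFst (PSeq PSnd PSnd) in
  p_map (PIf (p_arith OpLe a (PSeq bm PFst)) (PFork a bm) (PFork a (PFork a PSnd))).

(* Input (column, ((n, columns), scan state)), output the same environment with
   the updated index and rows. *)
Definition p_scan_update : prog :=
  let p' := p_arith OpAdd (PSeq PSnd (PSeq PSnd (PSeq PFst PFst))) (PConst 1) in
  let R := PSeq PSnd (PSeq PSnd (PSeq PFst PSnd)) in
  PFork (PSeq PSnd PFst)
    (PFork (PFork p' (PSeq (PFork (PSeq (PFork PFst R) p_zip) p') p_update_rows))
       (PSeq PSnd (PSeq PSnd PSnd))).

(** The list of columns of c is handed to the block loop as a unary counter, giving one round per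
    emitted column. *)
Definition p_blocks_init : prog :=
  let R := PSeq PSnd (PSeq PFst PSnd) in
  PFork (PSeq PFst PSnd)
    (PFork (PSeq PSnd (PSeq PFst PFst))
      (PFork (PFork (PConst 0) (PSeq PFst PFst))
         (PFork (PSeq (PFork R (PConst 0)) (p_map (PFork (PConst 0) (PSeq PFst PSnd))))
            (PConst 0)))).

Definition p_run_blocks : prog :=
  PFork PSnd (PSeq (PSeq p_blocks_init (p_fold p_block_step)) PSnd).

(* Input (scan state, (final rows, columns)). *)
Definition p_scan_best : prog :=
  let total := p_sum (PSeq PSnd PFst) in
  PSeq
    (PFork PFst (PFork (p_arith OpSub (PSeq (PSeq PFst (PSeq PFst PSnd)) total)
                                     (PSeq (PSeq PSnd PFst) total))
                   (PSeq PSnd PSnd)))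
    (PFork (PSeq PFst PFst)
       (PIf (p_arith OpLe (PSeq PSnd PFst) (PSeq PFst (PSeq PSnd PFst)))
          (PSeq PFst PSnd) PSnd)).

Definition p_scan_step : prog := PSeq p_scan_update (PSeq p_run_blocks p_scan_best).

(** The number n is the sum of ones over the list of columns. The dimension is visible only as the
    length of a column, so the zero rows are built from the first one, which exists as n > 0. *)
Definition p_scan_init : prog :=
  PFork PId (PFork (PFork (p_sum (PConst 1)) PId)
    (PFork (PFork (PConst 0) (PSeq (PFork PFst (PConst 0))
                                (p_map (PFork (PConst 0) (PFork (PConst 0) (PConst 0))))))
       (PFork (PConst 0)
          (PSeq (PFork PId (PConst 0))
             (p_map (PSeq (PFork PFst (PConst 0)) (p_map (PConst 0)))))))).

Definition p_main : prog :=
  PSeq p_scan_init (PSeq (p_fold p_scan_step) (PSeq PSnd PSnd)).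

(** * The program computes the scan *)

Section Correctness.
Variables (d : nat) (O : 'cV[int]_d -> 'cV[bool]_d).

Lemma evals_p_arith o p q v a b r :
  evals O p v (DInt a) -> evals O q v (DInt b) -> r = arith_eval o a b ->
  evals O (p_arith o p q) v (DInt r).
Proof.
by move=> h1 h2 ->; apply: evals_seq (evals_fork h1 h2) (evals_arith _ _ _ _).
Qed.

Ltac run' := run_with ltac:(first [solve [eauto] |
  lazymatch goal with
  | |- evals _ (p_arith _ _ _) _ _ => eapply evals_p_arith; [run' | run' | reflexivity]
  end]).

Lemma evals_dvec_map (F G : 'I_d -> datum) f E :
  (forall i, evals O f (DPair (F i) E) (G i)) ->
  evals O (p_map f) (DPair (dvec F) E) (dvec G).
Proof. exact: evals_p_map. Qed.

Lemma evals_weights (R : rows d) : evals O p_weights (enc_rows R) (enc_vec (weights R)).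
Proof.
apply: evals_seq; first by run.
by apply: evals_dvec_map => i; rewrite mxE /enc_row; run.
Qed.

Lemma evals_start_block (s : 'cV[bool]_d) (R : rows d) :
  evals O p_start_block (DPair (enc_vec (intmx s)) (enc_rows R))
    (enc_rows (start_block s R)).
Proof.
apply: evals_seq; first exact: evals_p_zip.
apply: evals_seq; first by run.
apply: evals_dvec_map => i; rewrite mxE /enc_row /start_block.
apply: (evals_if (b := s i 0)); first by run.
by case: (s i 0) => /=; run.
Qed.

Lemma evals_bit x E :
  evals O p_bit (DPair (enc_row x) E) (DInt (1 <= x.1)%R%:Z).
Proof. by rewrite /enc_row; apply: evals_p_arith => //; run. Qed.

Lemma evals_emit (R : rows d) : evals O p_emit (enc_rows R) (enc_vec (intmx (emit R))).
Proof.
apply: evals_seq; first by run.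
by apply: evals_dvec_map => i; rewrite !mxE; apply: evals_bit.
Qed.

Lemma evals_pay (R : rows d) : evals O p_pay (enc_rows R) (enc_rows (pay R)).
Proof.
apply: evals_seq; first by run.
apply: evals_dvec_map => i; rewrite /pay {2}/enc_row /=.
apply: evals_fork; last by run.
by apply: evals_p_arith (evals_bit _ _) _ => //; run.
Qed.

Lemma evals_block_step p (st : block_state d) x :
  evals O p_block_step (DPair x (DPair (DInt p) (enc_block st)))
    (enc_block (block_step O p st)).
Proof.
rewrite /block_step; apply: (evals_seq (u := enc_block (maybe_start O p st))).
  rewrite /maybe_start; apply: (evals_if (b := (st.1.1 <= 0) && (p <= st.1.2))).
    rewrite /enc_block; eapply evals_p_arith; last 1 first.
    (* The program multiplies two comparison bits; their product encodes the conjunction. *)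
    - by rewrite /=; instantiate (1 := (p <= st.1.2)%R%:Z);
        instantiate (1 := (st.1.1 <= 0)%R%:Z); case: (_ <= 0); case: (_ <= _).
    - by eapply evals_p_arith => //; run.
    by eapply evals_p_arith => //; run.
  case: ifP => _; last by rewrite /enc_block; run.
  rewrite /enc_block; apply: evals_fork; first by run.
  apply: evals_fork; last by run.
  apply: evals_seq (evals_start_block _ _); apply: evals_fork; last by run.
  apply: evals_seq (evals_query _ _); apply: evals_seq (evals_weights _).
  by run.
rewrite /enc_block /emit_column; move: (maybe_start _ _ _) => {}st.
apply: evals_fork; first by apply: evals_fork; apply: evals_p_arith => //; run.
apply: evals_fork.
  by apply: evals_seq (evals_pay _); run.
apply: evals_fork; last by run.
by apply: evals_seq (evals_emit _); run.
Qed.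

Lemma evals_update_rows p (R : rows d) e :
  evals O p_update_rows
    (DPair (dvec (fun i => DPair (DInt (e i)) (enc_row (R i)))) (DInt p))
    (enc_rows (fun i => update_row p (R i) (e i))).
Proof.
apply: evals_dvec_map => i; rewrite /update_row /enc_row.
set a := (R i).1 + e i.
apply: (evals_if (b := a <= (R i).2.1)).
  apply: evals_p_arith => //; last by run.
  by apply: evals_p_arith => //; run.
by case: ifP => _; (apply: evals_fork; first by apply: evals_p_arith => //; run);
  [run | apply: evals_fork; [apply: evals_p_arith => //; run | run]].
Qed.

Lemma evals_scan_update (c : 'cV[int]_d) n E (st : scan_state d) :
  evals O p_scan_update (DPair (enc_vec c) (DPair (DPair (DInt n) E) (enc_scan st)))
    (DPair (DPair (DInt n) E)
      (enc_scan ((st.1.1 + 1, fun i => update_row (st.1.1 + 1) (st.1.2 i) (c i 0)), st.2))).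
Proof.
have p'E : evals O (p_arith OpAdd (PSeq PSnd (PSeq PSnd (PSeq PFst PFst))) (PConst 1))
    (DPair (enc_vec c) (DPair (DPair (DInt n) E) (enc_scan st))) (DInt (st.1.1 + 1)).
  by rewrite /enc_scan; apply: evals_p_arith => //; run.
apply: evals_fork; first by run.
apply: evals_fork; last by rewrite /enc_scan; run.
apply: evals_fork => //.
apply: evals_seq (evals_update_rows _ _ _); apply: evals_fork => //.
apply: (evals_seq (u := DPair (enc_vec c) (enc_rows st.1.2))).
  by rewrite /enc_scan; run.
exact: evals_p_zip.
Qed.

Definition block_init n (R : rows d) : block_state d :=
  ((0, n), (fun i => (0, (R i).2), [::])).

Lemma evals_blocks_init n E (st : scan_state d) :
  evals O p_blocks_init (DPair (DPair (DInt n) E) (enc_scan st))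
    (DPair E (DPair (DInt st.1.1) (enc_block (block_init n st.1.2)))).
Proof.
rewrite /enc_scan /enc_block.
apply: evals_fork; first by run.
apply: evals_fork; first by run.
apply: evals_fork; first by run.
apply: evals_fork; last by run.
apply: (evals_seq (u := DPair (enc_rows st.1.2) (DInt 0))); first by run.
by apply: evals_dvec_map => i; rewrite /enc_row; run.
Qed.

Lemma evals_p_fold_block_step (s : seq datum) p (st : block_state d) :
  evals O (p_fold p_block_step) (DPair (dlist s) (DPair (DInt p) (enc_block st)))
    (enc_block (iter (size s) (block_step O p) st)).
Proof.
have := @evals_p_fold d O _ _ id (@enc_block d) (fun st _ => block_step O p st)
  p_block_step (DInt p) s st.
rewrite map_id (_ : foldl _ _ _ = iter (size s) (block_step O p) st).
  by apply=> x y; apply: evals_block_step.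
by elim: s st => //= x s IH st; rewrite IH -iterSr.
Qed.

Lemma evals_run_blocks (s : seq datum) (st : scan_state d) :
  evals O p_run_blocks (DPair (DPair (DInt (size s)%:Z) (dlist s)) (enc_scan st))
    (DPair (enc_scan st)
      (DPair (enc_rows (run_blocks O (size s) st.1.1 st.1.2).2.1)
             (enc_cols (run_blocks O (size s) st.1.1 st.1.2).2.2))).
Proof.
apply: evals_fork; first by run.
apply: (evals_seq (u := enc_block (run_blocks O (size s) st.1.1 st.1.2))).
  exact: evals_seq (evals_blocks_init _ _ _) (evals_p_fold_block_step _ _ _).
by rewrite /enc_block; run.
Qed.

Lemma evals_sum_rows (R : rows d) :
  evals O (p_sum (PSeq PSnd PFst)) (enc_rows R)
    (DInt (\sum_(i <- enum 'I_d) (R i).2.1)).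
Proof. by apply: evals_p_sum => i; rewrite /enc_row; run. Qed.

Lemma evals_scan_best (st : scan_state d) (R : rows d) out :
  evals O p_scan_best (DPair (enc_scan st) (DPair (enc_rows R) (enc_cols out)))
    (enc_scan (st.1, if saved st.1.2 R <= st.2.1 then st.2 else (saved st.1.2 R, out))).
Proof.
apply: (evals_seq (u := DPair (enc_scan st)
    (DPair (DInt (saved st.1.2 R)) (enc_cols out)))).
  apply: evals_fork; first by run.
  apply: evals_fork; last by run.
  rewrite /enc_scan; apply: evals_p_arith (erefl _).
    by apply: evals_seq (evals_sum_rows _); run.
  by apply: evals_seq (evals_sum_rows _); run.
rewrite /enc_scan; apply: evals_fork; first by run.
apply: (evals_if (b := saved st.1.2 R <= st.2.1)).
  by apply: evals_p_arith => //; run.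
by case: ifP => _; run.
Qed.

Lemma evals_scan_step (s : seq datum) (c : 'cV[int]_d) (st : scan_state d) :
  evals O p_scan_step
    (DPair (enc_vec c) (DPair (DPair (DInt (size s)%:Z) (dlist s)) (enc_scan st)))
    (enc_scan (scan_step O (size s) st c)).
Proof.
apply: evals_seq (evals_scan_update _ _ _ _) _.
apply: evals_seq (evals_run_blocks _ _) _.
exact: evals_scan_best.
Qed.

Definition scan_init n : scan_state d :=
  ((0, fun=> (0, (0, 0))), (0, nseq n (const_mx false))).

Lemma evals_scan_init n (c : 'M[int]_(d, n)) : (0 < n)%N ->
  evals O p_scan_init (enc_mx c)
    (DPair (enc_mx c) (DPair (DPair (DInt n%:Z) (enc_mx c)) (enc_scan (scan_init n)))).
Proof.
move=> n0; apply: evals_fork; first by run.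
apply: evals_fork.
  apply: evals_fork; last by run.
  rewrite (_ : n%:Z = \sum_(j <- enum 'I_n) 1).
    by apply: evals_p_sum => j; run.
  by rewrite big_enum /= sumr_const card_ord natz.
apply: evals_fork; apply: evals_fork; first by run.
- case: n c n0 => // n c _; rewrite /enc_mx enum_ordSl /=.
  apply: (evals_seq (u := DPair (enc_vec (col ord0 c)) (DInt 0))); first by run.
  by apply: evals_dvec_map => i; rewrite /enc_row; run.
- by run.
apply: evals_seq; first by run.
have -> : enc_cols (scan_init n).2.2 =
    dlist [seq enc_vec (intmx (const_mx false : 'cV[bool]_d)) | j <- enum 'I_n].
  congr dlist; rewrite /= -[X in nseq X _](size_enum_ord n).
  by elim: (enum _) => //= a l ->.
apply: evals_p_map => j; apply: evals_seq; first by run.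
by apply: evals_dvec_map => i; rewrite !mxE; run.
Qed.

Lemma evals_main n (c : 'M[int]_(d, n)) : (0 < n)%N ->
  evals O p_main (enc_mx c)
    (enc_cols (scan O n [seq col j c | j <- enum 'I_n]).2.2).
Proof.
move=> n0; apply: evals_seq (evals_scan_init c n0) _.
apply: (evals_seq (u := enc_scan (scan O n [seq col j c | j <- enum 'I_n]))); last first.
  by rewrite /enc_scan; run.
rewrite {1}/enc_mx (map_comp (@enc_vec d) (fun j => col j c)).
apply: evals_p_fold => e st.
have := evals_scan_step [seq enc_vec (col j c) | j <- enum 'I_n] e st.
by rewrite size_map size_enum_ord.
Qed.

End Correctness.

(** * Running time *)

Lemma ptime_p_arith o p q : ptime p -> ptime q -> ptime (p_arith o p q).
Proof. by move=> tp tq; apply: ptime_seq (ptime_fork tp tq) (ptime_arith o). Qed.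

#[export] Hint Resolve ptime_p_arith : ptime.

Lemma ptime_block_step : ptime p_block_step.
Proof.
rewrite /p_block_step /p_start_block /p_weights /p_pay /p_emit /p_bit.
by auto 40 with ptime.
Qed.

Lemma ptime_scan_update : ptime p_scan_update.
Proof. by rewrite /p_scan_update /p_update_rows; auto 40 with ptime. Qed.

Lemma ptime_blocks_init : ptime p_blocks_init.
Proof. by rewrite /p_blocks_init; auto 40 with ptime. Qed.

Lemma ptime_scan_best : ptime p_scan_best.
Proof. by rewrite /p_scan_best; auto 40 with ptime. Qed.

Lemma ptime_scan_init : ptime p_scan_init.
Proof. by rewrite /p_scan_init; auto 40 with ptime. Qed.

(** * Sizes of the loop states *)

Lemma datum_size_dlist_mem (X : Type) (F : X -> datum) (s : seq X) k x0 :
  (k < size s)%N -> (datum_size (F (nth x0 s k)) <= datum_size (dlist (map F s)))%N.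
Proof.
elim: s k => // x s IH [|k] /= ks; first lia.
by have := IH k ks; lia.
Qed.

Lemma datum_size_dvec_mem d (F : 'I_d -> datum) i :
  (datum_size (F i) <= datum_size (dvec F))%N.
Proof. by rewrite datum_size_dvec (bigD1 i) //=; lia. Qed.

Lemma size_dlist (s : seq datum) : (size s <= datum_size (dlist s))%N.
Proof. by elim: s => //= x s IH; lia. Qed.

Lemma dim_dvec d (F : 'I_d -> datum) : (d <= datum_size (dvec F))%N.
Proof. by rewrite -{1}(size_enum_ord d) -(size_map F); apply: size_dlist. Qed.

Lemma datum_size_dvec_le d (F : 'I_d -> datum) B :
  (forall i, datum_size (F i) <= B)%N -> (datum_size (dvec F) <= d * B.+1 + 2)%N.
Proof.
move=> FB; rewrite datum_size_dvec leq_add2r.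
apply: (@leq_trans (\sum_(i < d) B.+1)%N).
  by apply: leq_sum => i _; apply: FB.
by rewrite sum_nat_const card_ord.
Qed.

Lemma datum_size_enc_cols d (out : seq 'cV[bool]_d) :
  (datum_size (enc_cols out) <= size out * (d * 3 + 3) + 2)%N.
Proof.
elim: out => //= x out IH.
have : (datum_size (enc_vec (intmx x)) <= d * 3 + 2)%N.
  by apply: datum_size_dvec_le => i; rewrite /= mxE; case: (x i 0).
by rewrite -/(enc_cols out) mulSn; lia.
Qed.

Definition row_bounded (B : nat) (x : int * (int * int)) : Prop :=
  [/\ int_size x.1 <= B, int_size x.2.1 <= B & int_size x.2.2 <= B]%N.

Lemma datum_size_enc_rows d (R : rows d) B :
  (forall i, row_bounded B (R i)) ->
  (datum_size (enc_rows R) <= d * (3 * B + 3) + 2)%N.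
Proof.
move=> RB.
have h : (datum_size (enc_rows R) <= d * (3 * B + 2).+1 + 2)%N.
  by apply: datum_size_dvec_le => i; have [] := RB i; rewrite /enc_row /=; lia.
by apply: leq_trans h _; rewrite -addnS.
Qed.

Lemma row_bounded_enc d (R : rows d) i : row_bounded (datum_size (enc_rows R)) (R i).
Proof.
have := datum_size_dvec_mem (fun i => enc_row (R i)) i.
by rewrite -/(enc_rows R) /enc_row /=; split; lia.
Qed.

Lemma row_boundedW B B' x : (B <= B')%N -> row_bounded B x -> row_bounded B' x.
Proof. by move=> BB' [h1 h2 h3]; split; apply: leq_trans BB'. Qed.

Definition block_bounded d (B : nat) (st : block_state d) : Prop :=
  [/\ int_size st.1.1 <= B, int_size st.1.2 <= B
    & forall i, row_bounded B (st.2.1 i)]%N.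

Section BlockBounds.
Variables (d : nat) (O : 'cV[int]_d -> 'cV[bool]_d).

(** The increase 2 is the size of the subtracted bit; so crude a bound is harmless over linearly
    many rounds. *)
Lemma block_bounded_step B p (st : block_state d) :
  (int_size p <= B)%N -> block_bounded B st ->
  block_bounded B.+2 (block_step O p st).
Proof.
move=> pB stB; have : block_bounded B (maybe_start O p st).
  rewrite /maybe_start; case: ifP => // _; have [tB jB RB] := stB; split=> //= i.
  rewrite /start_block; case: ifP => // _; have [h1 h2 h3] := RB i; split=> //=;
  exact: leq_trans h3.
rewrite /block_step; move: (maybe_start _ _ _) => {stB}st [tB jB RB].
split=> [||i] /=.
- by apply: leq_trans (int_sizeB _ _) _; rewrite -addn2 leq_add.
- by apply: leq_trans (int_sizeB _ _) _; rewrite -addn2 leq_add.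
have [h1 h2 h3] := RB i; rewrite /pay; split=> /=; try by rewrite -addn2 ltn_addr.
  apply: leq_trans (int_sizeB _ _) _; rewrite -addn2 leq_add //.
  by case: (1 <= _)%R.
all: by rewrite !leqW.
Qed.

Lemma size_block_step p (st : block_state d) :
  (size (block_step O p st).2.2 <= (size st.2.2).+1)%N.
Proof. by rewrite /block_step /maybe_start; case: ifP. Qed.

Lemma iter_block_bounded k B p st :
  (int_size p <= B)%N -> block_bounded B st ->
  block_bounded (B + k.*2) (iter k (block_step O p) st) /\
  (size (iter k (block_step O p) st).2.2 <= size st.2.2 + k)%N.
Proof.
move=> pB stB; elim: k => [|k [IH1 IH2]]; first by rewrite !addn0.
rewrite iterS doubleS !addnS; split.
  by apply: block_bounded_step => //; apply: leq_trans pB (leq_addr _ _).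
by apply: leq_trans (size_block_step _ _) _; rewrite ltnS.
Qed.

Lemma datum_size_enc_block B (st : block_state d) : block_bounded B st ->
  (datum_size (enc_block st) <=
   2 * B + d * (3 * B + 3) + size st.2.2 * (d * 3 + 3) + 7)%N.
Proof.
move=> [tB jB RB]; have := datum_size_enc_rows RB.
by have := datum_size_enc_cols st.2.2; rewrite /=; lia.
Qed.

Lemma block_bounded_enc (st : block_state d) :
  block_bounded (datum_size (enc_block st)) st.
Proof.
split=> /=; [lia|lia|move=> i].
by apply: row_boundedW (row_bounded_enc _ i); lia.
Qed.

End BlockBounds.

Definition block_domain : domain := fun d O v =>
  exists (s : seq datum) p (st : block_state d),
    v = DPair (dlist s) (DPair (DInt p) (enc_block st)).

(** [ptime_p_fold] does not fit: a round appends a column of d entries, and neither an arbitrary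
    list element nor p bounds d. Instead the invariant says that the state after k rounds is the
    k-th iterate. *)
Lemma ptime_p_fold_block_step : ptime_on block_domain (p_fold p_block_step).
Proof.
(* K bounds the list length, d, the initial integer sizes and the initial number of columns. At most
   K rounds bring integers to K + 2 K bits and columns to 2 K. *)
pose f K := (K + (2 * (K + K + K) + K * (3 * (K + K + K) + 3) + (K + K) * (K * 3 + 3) + 7))%N.
have [P fP] : poly_bounded f by rewrite /f; auto 30 with polyb.
apply: (ptime_p_fold_on (P := P) ptime_block_step) => d O L0 E A0 v0.
move=> [s [p [st [? ? ?]]]]; subst L0 E A0; set K := datum_size v0.
exists (fun L A => exists2 k, (k <= size s)%N &
  L = dlist (drop k s) /\ A = enc_block (iter k (block_step O p) st)); split=> //.
- by exists 0%N; rewrite ?drop0.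
- move=> x L A r [k ks [LE ->]] ev; move: LE ks.
  rewrite leq_eqVlt => LE /predU1P[kE|ks].
    by move: LE; rewrite kE drop_size.
  move: LE; rewrite (drop_nth (DInt 0) ks) /= => -[_ ->].
  exists k.+1 => //; split=> //; rewrite iterS.
  exact: evals_det ev (evals_block_step _ _ _ _).
move=> L A [k ks [-> ->]]; apply: leq_trans (fP K).
have KE : K = (datum_size (dlist s) + (int_size p + datum_size (enc_block st)).+1).+1 by [].
have stE : datum_size (enc_block st) = ((int_size st.1.1 + int_size st.1.2).+1 +
  (datum_size (enc_rows st.2.1) + datum_size (enc_cols st.2.2)).+1).+1 by [].
have Ks : (size s <= K)%N by have := size_dlist s; lia.
have Kd : (d <= K)%N by have := dim_dvec (fun i => enc_row (st.2.1 i)); rewrite -/(enc_rows _); lia.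
have Ko : (size st.2.2 <= K)%N.
  have := size_dlist [seq enc_vec (intmx x) | x <- st.2.2].
  by rewrite size_map -/(enc_cols _); lia.
have stB : block_bounded K st.
  have [h1 h2 h3] := block_bounded_enc st.
  have sK : (datum_size (enc_block st) <= K)%N by lia.
  by split=> [||i]; [exact: leq_trans sK|exact: leq_trans sK|exact: row_boundedW (h3 i)].
have pB : (int_size p <= K)%N by lia.
have [kB ko] := iter_block_bounded O k pB stB.
have kB' : block_bounded (K + K + K) (iter k (block_step O p) st).
  have kK : (K + k.*2 <= K + K + K)%N by lia.
  have [h1 h2 h3] := kB.
  by split=> [||i]; [exact: leq_trans kK|exact: leq_trans kK|exact: row_boundedW (h3 i)].
rewrite /f; apply: leq_add.
  have : (datum_size (dlist (drop k s)) <= datum_size (dlist s))%N.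
    by elim: (s) (k) => [|x s' IH] [|k'] //=; have := IH k'; lia.
  by lia.
apply: leq_trans (datum_size_enc_block kB') _.
rewrite leq_add2r; apply: leq_add; last by apply: leq_mul; lia.
by rewrite leq_add2l leq_mul2r; lia.
Qed.

Definition scan_bounded d (B V : nat) (st : scan_state d) : Prop :=
  [/\ int_size st.1.1 <= B, forall i, row_bounded B (st.1.2 i),
      int_size st.2.1 <= V & size st.2.2 <= V]%N.

Lemma int_size_sum (I : Type) (r : seq I) (F : I -> int) B :
  (forall i, int_size (F i) <= B)%N ->
  (int_size (\sum_(i <- r) F i)%R <= size r * B + 2)%N.
Proof.
move=> FB; elim: r => [|x r IH]; first by rewrite big_nil.
rewrite big_cons /= mulSn -addnA; apply: leq_trans (int_sizeD _ _) _.
exact: leq_add.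
Qed.

Lemma row_bounded_update B K p x e : (int_size p <= B + K)%N -> (int_size e <= K)%N ->
  row_bounded B x -> row_bounded (B + K) (update_row p x e).
Proof.
move=> pB eK [h1 h2 h3].
have aB : (int_size (x.1 + e) <= B + K)%N.
  by apply: leq_trans (int_sizeD _ _) (leq_add h1 eK).
by rewrite /update_row; case: ifP => _; split=> //=; apply: leq_trans (leq_addr _ _).
Qed.

(** Two budgets are needed: prefix sums grow with every column of c, while the stored solution is
    either kept or recomputed from bounded rows, so [V] does not accumulate. *)
Lemma scan_bounded_step d (O : 'cV[int]_d -> 'cV[bool]_d) n B K V (st : scan_state d) (c : 'cV[int]_d) :
  (int_size n%:Z <= B)%N -> (2 <= K)%N -> (forall i, int_size (c i 0%R) <= K)%N ->
  (2 * (d * (B + K + n.*2) + 2) + n <= V)%N ->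
  scan_bounded B V st -> scan_bounded (B + K) V (scan_step O n st c).
Proof.
move=> nB K2 cK VB [pB RB vV sV]; rewrite /scan_step.
set p := st.1.1 + 1; set R : rows d := fun i => _.
have pB' : (int_size p <= B + K)%N.
  have K2' : (int_size 1 <= K)%N by [].
  exact: leq_trans (int_sizeD _ _) (leq_add pB K2').
have RB' i : row_bounded (B + K) (R i) by apply: row_bounded_update.
have initB : block_bounded (B + K) (block_init n%:Z R).
  have zB : (int_size 0 <= B + K)%N by apply: leq_trans K2 (leq_addl _ _).
  split=> [||i] //=; first exact: leq_trans nB (leq_addr _ _).
  by have [_ h2 h3] := RB' i; split.
have [[_ _ endB] outn] := iter_block_bounded O n pB' initB.
have savedV : (int_size (saved R (run_blocks O n p R).2.1) <= V)%N.
  apply: leq_trans (int_sizeB _ _) _; apply: leq_trans VB.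
  have sumB (R' : rows d) : (forall i, row_bounded (B + K + n.*2) (R' i)) ->
      (int_size (\sum_(i <- enum 'I_d) (R' i).2.1)%R <= d * (B + K + n.*2) + 2)%N.
    move=> R'B; have := @int_size_sum _ (enum 'I_d) (fun i => (R' i).2.1) (B + K + n.*2).
    by rewrite size_enum_ord; apply=> i; have [] := R'B i.
  have h1 := sumB _ endB.
  have h2 : (int_size (\sum_(i <- enum 'I_d) (R i).2.1)%R <= d * (B + K + n.*2) + 2)%N.
    by apply: sumB => i; apply: row_boundedW (RB' i); apply: leq_addr.
  by apply: leq_trans (leq_add h2 h1) _; lia.
split=> //=; first by case: ifP.
case: ifP => //= _; apply: leq_trans outn _; rewrite add0n; lia.
Qed.

Lemma datum_size_enc_scan d B V (st : scan_state d) : scan_bounded B V st ->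
  (datum_size (enc_scan st) <= B + d * (3 * B + 3) + V + V * (d * 3 + 3) + 7)%N.
Proof.
move=> [pB RB vV sV]; have h1 := datum_size_enc_rows RB.
have := datum_size_enc_cols st.2.2.
have := leq_mul sV (leqnn (d * 3 + 3)%N).
by rewrite /=; lia.
Qed.

Definition step_domain : domain := fun d O v =>
  exists (s : seq datum) (c : 'cV[int]_d) (st : scan_state d),
    v = DPair (enc_vec c) (DPair (DPair (DInt (size s)%:Z) (dlist s)) (enc_scan st)).

(** The block loop has its time bound on encoded block states, so exact evaluation of the preceding
    programs must show that such a state reaches it. *)
Lemma ptime_scan_step : ptime_on step_domain p_scan_step.
Proof.
pose D1 : domain := fun d O v => exists (s : seq datum) (st : scan_state d),
  v = DPair (DPair (DInt (size s)%:Z) (dlist s)) (enc_scan st).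
apply: (@ptime_seq_on _ D1); first exact: ptime_sub ptime_scan_update.
  apply: (@ptime_seq_on _ anywhere) => //; last exact: ptime_scan_best.
  apply: ptime_fork_on; first exact: ptime_sub ptime_snd.
  apply: (@ptime_seq_on _ anywhere) => //; last exact: ptime_snd.
  apply: ptime_seq_on ptime_p_fold_block_step _.
    exact: ptime_sub ptime_blocks_init.
  move=> d O v u [s [st ->]] ev.
  by have -> := evals_det ev (evals_blocks_init _ _ _ _); do 3 eexists.
move=> d O v u [s [c [st ->]]] ev.
by have -> := evals_det ev (evals_scan_update _ _ _ _ _); do 2 eexists.
Qed.

Definition scan_domain : domain := fun d O v =>
  exists (s : seq 'cV[int]_d) (st : scan_state d),
    let cols := dlist [seq enc_vec c | c <- s] in
    v = DPair cols (DPair (DPair (DInt (size s)%:Z) cols) (enc_scan st)).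

Lemma ptime_p_fold_scan_step : ptime_on scan_domain (p_fold p_scan_step).
Proof.
(* At most K columns of c each add at most K bits to the rows; [V] then covers the two sums in
   [saved] after a further block run. *)
pose B K := (K + K * K)%N.
pose V K := (2 * (K * (B K + 2 * K) + 2) + K + K)%N.
pose f K := (K + (B K + K * (3 * B K + 3) + V K + V K * (K * 3 + 3) + 7))%N.
have [P fP] : poly_bounded f by rewrite /f /V /B; auto 40 with polyb.
apply: (ptime_p_fold_on (P := P) ptime_scan_step) => d O L0 E A0 v0.
move=> [s [st [? ? ?]]]; subst L0 E A0; set K := datum_size v0.
have KE : K = (datum_size (dlist [seq enc_vec c | c <- s]) +
  ((int_size (size s)%:Z + datum_size (dlist [seq enc_vec c | c <- s])).+1 +
    datum_size (enc_scan st)).+1).+1 by [].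
have stE : datum_size (enc_scan st) = ((int_size st.1.1 + datum_size (enc_rows st.1.2)).+1 +
  (int_size st.2.1 + datum_size (enc_cols st.2.2)).+1).+1 by [].
have Ks : (size s <= K)%N.
  by have := size_dlist [seq enc_vec c | c <- s]; rewrite size_map; lia.
have Kd : (d <= K)%N by have := dim_dvec (fun i => enc_row (st.1.2 i)); rewrite -/(enc_rows _); lia.
have Ko : (size st.2.2 <= K)%N.
  have := size_dlist [seq enc_vec (intmx x) | x <- st.2.2].
  by rewrite size_map -/(enc_cols _); lia.
have VK : (2 * (d * (B K + (size s).*2) + 2) + size s <= V K)%N.
  by rewrite /V -mul2n; have := leq_mul Kd (_ : B K + 2 * size s <= B K + 2 * K)%N; lia.
have stB k : (k <= size s)%N -> scan_bounded (K + k * K) (V K)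
    (foldl (scan_step O (size s)) st (take k s)).
  elim: k => [_|k IH ks].
    rewrite take0 /= mul0n addn0; split.
    - lia.
    - by move=> i; apply: row_boundedW (row_bounded_enc _ i); lia.
    - by rewrite /V; lia.
    - by rewrite /V; lia.
  rewrite (take_nth 0 ks) foldl_rcons mulSn [(K + k * K)%N]addnC addnA.
  have kK : (k.+1 * K <= K * K)%N by rewrite leq_mul2r; lia.
  apply: scan_bounded_step (IH (ltnW ks)); [lia|lia| |].
    move=> i; have h1 := datum_size_dlist_mem (@enc_vec d) 0 ks.
    have h2 : (int_size (nth 0%R s k i 0%R) <= datum_size (enc_vec (nth 0%R s k)))%N.
      exact: (datum_size_dvec_mem (fun i => DInt (nth 0 s k i 0))).
    by apply: leq_trans h2 (leq_trans h1 _); rewrite KE; apply: leqW; apply: leq_addr.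
  apply: leq_trans VK; rewrite leq_add2r leq_mul2l leq_add2r leq_mul2l leq_add2r.
  by rewrite -addnA leq_add2l -mulSnr kK !orbT.
exists (fun L A => exists2 k, (k <= size s)%N & L = dlist [seq enc_vec c | c <- drop k s] /\
  A = enc_scan (foldl (scan_step O (size s)) st (take k s))); split=> //.
- by exists 0%N; rewrite ?drop0 ?take0.
- move=> x L A [k ks [LE ->]]; move: LE ks.
  rewrite leq_eqVlt => LE /predU1P[kE|ks].
    by move: LE; rewrite kE drop_size.
  move: LE; rewrite (drop_nth 0 ks) /= => -[-> _].
  exists [seq enc_vec c | c <- s], (nth 0 s k), (foldl (scan_step O (size s)) st (take k s)).
  by rewrite size_map.
- move=> x L A r [k ks [LE ->]] ev; move: LE ks.
  rewrite leq_eqVlt => LE /predU1P[kE|ks].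
    by move: LE; rewrite kE drop_size.
  move: LE; rewrite (drop_nth 0 ks) /= => -[xE ->].
  exists k.+1 => //; split=> //; rewrite (take_nth 0 ks) foldl_rcons.
  have := evals_scan_step O [seq enc_vec c | c <- s] (nth 0 s k)
    (foldl (scan_step O (size s)) st (take k s)).
  by rewrite size_map -xE => /(evals_det ev).
move=> L A [k ks [-> ->]]; apply: leq_trans (fP K).
rewrite /f; apply: leq_add.
  have : (datum_size (dlist [seq enc_vec c | c <- drop k s]) <=
      datum_size (dlist [seq enc_vec c | c <- s]))%N.
    by elim: (s) (k) => [|x s' IH] [|k'] //=; have := IH k'; lia.
  by lia.
apply: leq_trans (datum_size_enc_scan (stB k ks)) _.
have kB : (K + k * K <= B K)%N by rewrite leq_add2l leq_mul2r; lia.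
rewrite leq_add2r; apply: leq_add; last by apply: leq_mul => //; lia.
by rewrite leq_add2r; apply: leq_add => //; apply: leq_mul => //; lia.
Qed.

Definition matrix_domain : domain := fun d O v =>
  exists (n : nat) (c : 'M[int]_(d, n)), (0 < n)%N /\ v = enc_mx c.

Lemma ptime_main : ptime_on matrix_domain p_main.
Proof.
apply: (@ptime_seq_on _ scan_domain); first exact: ptime_sub ptime_scan_init.
  apply: (@ptime_seq_on _ anywhere) => //; first exact: ptime_p_fold_scan_step.
  exact: ptime_seq ptime_snd ptime_snd.
move=> d O v u [n [c [n0 ->]]] ev; rewrite (evals_det ev (evals_scan_init _ c n0)).
exists [seq col j c | j <- enum 'I_n], (scan_init d n).
by rewrite /= size_map size_enum_ord -map_comp.
Qed.

Lemma approx_polytime (R : realType) :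
  shifted_approx_polytime independence_system
    (fun n => 1 / (4 * up_log 2 n + 8)%:R : R).
Proof.
have [T tT] := ptime_main.
exists p_main, T => d n c S O n0 indS optO.
have [_ _ _ v0 [y [Sy yE vE]] _] := scanP c indS optO.
have [t e] := evals_main O c n0.
exists y, t; split=> //.
- rewrite {1}yE /enc_cols -map_comp in e.
  rewrite /enc_mx; congr (exec _ _ _ (dlist _) _): e; apply: eq_map => j /=.
  by congr enc_vec; apply/matrixP => a b; rewrite !mxE.
- by apply: tT e; exists n, c.
move=> z Sz; have := scan_ratio c indS optO n0 Sz.
rewrite -vE; set v := (scan _ _ _).2.1 in v0 *; set w := mxdot _ _ => h.
have D0 : 0 < (4 * up_log 2 n + 8)%:R :> R by rewrite ltr0n addnS.
rewrite mulrC mulrA mulr1 ler_pdivrMr // pmulrn -intrM ler_int.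
(* The factor 4 (L + 1) is below 4 L + 8, and v >= 0. *)
apply: le_trans h _; rewrite mulrC ler_wpM2l //; lia.
Qed.

(** * The greedy algorithm for disjoint unions *)

(** This is 1 + x <= e^x at x = -1/n, raised to the n-th power; n > 0 makes the base nonnegative. *)
Lemma greedy_ratio_ge (R : realType) (n : nat) : (0 < n)%N ->
  1 - (expR 1)^-1 <= greedy_ratio R n.
Proof.
move=> n0; rewrite /greedy_ratio lerD2l lerN2.
have n0' : n%:R != 0 :> R by rewrite pnatr_eq0 -lt0n.
have -> : (expR 1)^-1 = expR (- n%:R^-1) ^+ n :> R.
  by rewrite -expRM_natl mulrN mulfV // expRN.
apply: lerXn2r.
- by rewrite nnegrE subr_ge0 invf_le1 ?ler1n // ltr0n.
- by rewrite nnegrE expR_ge0.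
exact: expR_ge1Dx.
Qed.

Lemma inv_e_le (R : realType) : 6321%:R / 10000%:R <= 1 - (expR 1)^-1 :> R.
Proof.
(* The goal amounts to e >= 1 / 0.3679 = 2.71813...; the first eight terms of the series give
   2.71825..., and 2.71815 lies between. *)
have e_ge : 2718%:R / 1000%:R + 15%:R / (100%:R * 1000%:R) <= expR 1 :> R.
  have h8 : series (exp_coeff 1) 8 <= expR 1 :> R.
    apply: nondecreasing_cvgn_le (is_cvg_series_exp_coeff 1) 8.
    by apply: nondecreasing_series => k _ _; apply: exp_coeff_ge0.
  apply: le_trans h8; rewrite /series /= !big_nat_recr //= big_nil /exp_coeff /=.
  rewrite !expr1n (factS 6) natrM (_ : 6`! = 720)%N // (_ : 5`! = 120)%N //.
  rewrite (_ : 4`! = 24)%N // (_ : 3`! = 6)%N // (_ : (1 + 1)%R`! = 2)%N // (_ : 1`! = 1)%N //.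
  rewrite fact0; lra.
have e0 : 0 < expR 1 :> R by apply: expR_gt0.
have -> : 6321%:R = 49%:R * 129%:R :> R by rewrite -natrM.
have -> : 10000%:R = 100%:R * 100%:R :> R by rewrite -natrM.
have h : (expR 1)^-1 <= 3679%:R / (100%:R * 100%:R) :> R.
  rewrite -[_ / _]invrK lef_pV2 ?posrE ?invr_gt0 //; last by lra.
  by rewrite invf_div; lra.
lra.
Qed.

Section Greedy.
Variables (d n : nat) (S : {set 'cV[bool]_d}) (O : 'cV[int]_d -> 'cV[bool]_d).
Variable w : 'cV[int]_d.
Hypotheses (indS : independence_system S) (optO : lin_opt_oracle S O).

Definition residual (xs : seq 'cV[bool]_d) : 'cV[int]_d :=
  \col_i if covered xs i then 0 else w i 0.

Definition covered_weight (xs : seq 'cV[bool]_d) : int :=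
  \sum_(i < d) w i 0 * (covered xs i)%:Z.

Lemma covered_rcons (xs : seq 'cV[bool]_d) x i :
  covered (rcons xs x) i = covered xs i || x i 0.
Proof. by rewrite /covered has_rcons orbC. Qed.

Lemma size_greedy_queries k : size (greedy_queries O w k) = k.
Proof. by elim: k => //= k IH; rewrite size_rcons IH. Qed.

Lemma greedy_queries_in k x : x \in greedy_queries O w k -> x \in S.
Proof.
elim: k => //= k IH; rewrite mem_rcons in_cons => /orP[/eqP->|//].
by have [] := optO (\col_i (if covered (greedy_queries O w k) i then 0 else w i 0)).
Qed.

(** Deleting i from the answer stays in S by downward monotonicity, so optimality excludes a
    negative weight. *)
Lemma oracle_nonneg (v : 'cV[int]_d) i : O v i 0 -> 0 <= v i 0.
Proof.
move=> Oi; have [sS max] := optO v.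
pose s : 'cV[bool]_d := \col_k (O v k 0 && (k != i)).
have /max : s \in S.
  by apply: indS.2 sS _ => k; rewrite mxE; case: (O v k ord0); case: (k == i).
rewrite !mxdot_cV (bigD1 i) //= [X in _ <= X -> _](bigD1 i) //=.
rewrite mxE eqxx andbF mulr0 add0r Oi mulr1.
under eq_bigr => k ki do rewrite mxE ki andbT.
by rewrite lerDr.
Qed.

Lemma covered_nonneg k i : covered (greedy_queries O w k) i -> 0 <= w i 0.
Proof.
elim: k => //= k IH; rewrite covered_rcons => /orP[//|/oracle_nonneg].
by rewrite mxE; case: ifP => // /IH.
Qed.

Lemma covered_weight_step k :
  covered_weight (greedy_queries O w k.+1) = covered_weight (greedy_queries O w k) +
    mxdot (residual (greedy_queries O w k))
          (intmx (O (residual (greedy_queries O w k)))).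
Proof.
rewrite /covered_weight mxdot_cV -big_split /=; apply: eq_bigr => i _.
rewrite covered_rcons -/(residual _) mxE.
by case: (covered _ i); rewrite /= ?mul0r ?mulr0 ?addr0 ?add0r.
Qed.

Lemma colsumE k (x : 'M[bool]_(d, k)) i : colsum x i 0 = \sum_(j < k) (x i j)%:Z.
Proof. by rewrite /colsum summxE; apply: eq_bigr => j _; rewrite !mxE. Qed.

Lemma dup_valueE k (x : 'M[bool]_(d, k)) :
  dup_value w x = \sum_(i < d) w i 0 * colsum x i 0.
Proof. by apply: eq_bigr => i _; rewrite big_ord1. Qed.

(** A covered row has exactly one first occurrence. Keeping only these makes the answers disjoint
    without uncovering any row. *)
Lemma first_cover (xs : seq 'cV[bool]_d) i :
  (\sum_(j < size xs)
    (nth (const_mx false) xs j i ord0 && ~~ covered (take j xs) i) = covered xs i)%N.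
Proof.
elim/last_ind: xs => [|xs x IH]; first by rewrite big_ord0.
rewrite size_rcons big_ord_recr /= nth_rcons ltnn eqxx -cats1 take_size_cat //.
rewrite cats1 covered_rcons.
under eq_bigr => j _ do rewrite nth_rcons ltn_ord -cats1 takel_cat ?(ltnW (ltn_ord j)) //.
by rewrite IH; case: (covered xs i); case: (x i 0).
Qed.

Lemma colsum_greedy i :
  colsum (greedy O w n) i 0 = (covered (greedy_queries O w n) i)%:Z.
Proof.
rewrite colsumE -first_cover size_greedy_queries.
by rewrite -natz natr_sum; apply: eq_bigr => j _; rewrite mxE natz.
Qed.

Lemma greedy_feasible : dup_feasible S (greedy O w n).
Proof.
split=> [j|i]; last by rewrite colsum_greedy; case: covered; [right|left].
apply: (indS.2 _ (nth (const_mx false) (greedy_queries O w n) j)).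
  by apply: (@greedy_queries_in n); rewrite mem_nth // size_greedy_queries.
by move=> i; rewrite !mxE; case: covered; rewrite ?andbF ?andbT.
Qed.

(** On uncovered rows the averaging bound applies to the columns of x. On covered rows the weights
    are nonnegative, so x takes there no more than is already counted. *)
Lemma greedy_gain k (x : 'M[bool]_(d, n)) : dup_feasible S x ->
  dup_value w x - covered_weight (greedy_queries O w k) <=
  n%:Z * (covered_weight (greedy_queries O w k.+1)
          - covered_weight (greedy_queries O w k)).
Proof.
move=> [Sx x01]; rewrite covered_weight_step [covered_weight _ + _]addrC addrK.
apply: le_trans (oracle_average optO _ Sx).
rewrite dup_valueE /covered_weight -sumrB; apply: ler_sum => i _.
have -> : (count_row x i)%:Z = colsum x i 0.
  by rewrite colsumE /count_row -natz natr_sum; apply: eq_bigr => j _; rewrite natz.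
rewrite mxE; case: ifP => [/covered_nonneg w0|_]; last by rewrite mulr0 subr0.
by rewrite mul0r mulr1; case: (x01 i) => ->; lia.
Qed.

(** As for maximum coverage, each query multiplies the upper bound on the gap to the value of x by 1
    - 1/n. *)
Lemma greedy_approx (R : realType) (x : 'M[bool]_(d, n)) : (0 < n)%N ->
  dup_feasible S x ->
  greedy_ratio R n * (dup_value w x)%:~R <= (dup_value w (greedy O w n))%:~R.
Proof.
move=> n0 fx.
have -> : dup_value w (greedy O w n) = covered_weight (greedy_queries O w n).
  by rewrite dup_valueE; apply: eq_bigr => i _; rewrite colsum_greedy.
set opt := (dup_value w x)%:~R : R.
pose G k := (covered_weight (greedy_queries O w k))%:~R : R.
have nR : 0 < n%:R :> R by rewrite ltr0n.
have step k : opt - G k.+1 <= (1 - n%:R^-1) * (opt - G k).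
  have := greedy_gain k fx; rewrite -(ler_int R) intrM !intrB -/opt -/(G _) -/(G _).
  rewrite -ler_pdivrMl // => h; rewrite mulrBl mul1r; lra.
suff h k : opt - G k <= (1 - n%:R^-1) ^+ k * opt.
  by have := h n; rewrite /greedy_ratio -/(G n); lra.
elim: k => [|k IH].
  rewrite expr0 mul1r gerBl /G /covered_weight big1 //= => i _.
  by rewrite mulr0.
apply: le_trans (step k) _; rewrite exprS -mulrA ler_wpM2l //.
by rewrite subr_ge0 invf_le1 // ler1n.
Qed.

End Greedy.

(** A smaller ratio is a weaker demand only when the value of z is nonnegative. For negative values
    the claim follows from y having nonnegative value, which is the guarantee applied to the zero
    matrix. *)
Lemma shifted_approx_weaken (R : realType) (C : set_class) (rho rho' : nat -> R) :
  (forall d (S : {set 'cV[bool]_d}), C d S -> independence_system S) ->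
  (forall n, (0 < n)%N -> 0 <= rho n <= rho' n) ->
  shifted_approx_polytime independence_system rho' -> shifted_approx_polytime C rho.
Proof.
move=> indC rho_le [P [T PT]]; exists P, T => d n c S O n0 CS optO.
have [y [t [e tT Sy apx]]] := PT d n c S O n0 (indC _ _ CS) optO.
exists y, t; split=> // z Sz; have /andP[r0 rle] := rho_le n n0.
pose zero : 'M[bool]_(d, n) := const_mx false.
have Szero : in_power S zero.
  move=> j; have [S0 _] := indC _ _ CS.
  by have -> : col j zero = const_mx false by apply/matrixP => a b; rewrite !mxE.
have y0 : 0 <= (mxdot c (shift (intmx y)))%:~R :> R.
  apply: le_trans (apx _ Szero); rewrite mxdot_shift big1 ?mulr0 // => i _.
  by rewrite /count_row big1 ?prefix_sum0 // => j _; rewrite mxE.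
have [z0|z0] := leP 0 (mxdot c (shift (intmx z))).
  by apply: le_trans (apx z Sz); rewrite ler_wpM2r // ler0z.
by apply: le_trans y0; rewrite mulr_ge0_le0 // lerz0 ltW.
Qed.

Theorem theorem4p3 (R : realType) :
  shifted_approx_polytime independence_system
    (fun n => greedy_ratio R n / (4 * up_log 2 n + 8)%:R) /\
  (forall n : nat, (0 < n)%N -> 1 - (expR 1)^-1 <= greedy_ratio R n) /\
  6321%:R / 10000%:R <= 1 - (expR 1)^-1 :> R /\
  (forall (d n : nat) (S : {set 'cV[bool]_d}) (O : 'cV[int]_d -> 'cV[bool]_d)
          (w : 'cV[int]_d),
     (0 < n)%N -> independence_system S -> lin_opt_oracle S O ->
     dup_feasible S (greedy O w n) /\
     forall x : 'M[bool]_(d, n), dup_feasible S x ->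
       greedy_ratio R n * (dup_value w x)%:~R <= (dup_value w (greedy O w n))%:~R) /\
  (forall C : set_class,
     (forall d (S : {set 'cV[bool]_d}), C d S -> independence_system S) ->
     dup_polytime C ->
     shifted_approx_polytime C
       (fun n => 1 / (4 * up_log 2 n + 8)%:R : R)).
Proof.
have D0 n : 0 < (4 * up_log 2 n + 8)%:R :> R by rewrite ltr0n addnS.
split; [|split; [|split; [|split]]].
- apply: shifted_approx_weaken (approx_polytime R) => // n n0.
  have q0 : 0 <= 1 - n%:R^-1 :> R by rewrite subr_ge0 invf_le1 ?ler1n ?ltr0n.
  apply/andP; split; last first.
    by rewrite ler_pM2r ?invr_gt0 // gerBl exprn_ge0.
  apply: divr_ge0; last exact: ltW.
  by rewrite subr_ge0 exprn_ile1 // gerBl invr_ge0.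
- exact: greedy_ratio_ge.
- exact: inv_e_le.
- move=> d n S O w n0 indS optO; split; first exact: greedy_feasible.
  by move=> x; apply: greedy_approx.
move=> C indC _; apply: shifted_approx_weaken (approx_polytime R) => // n _.
by rewrite lexx andbT divr_ge0 // ltW.
Qed.
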